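(* Let $\Gamma$ be a piecewise trivial suspension and let $T$ be a canonical structural tree. Let $\mathbb X$ be the graph of groups dual to $T$ (the quotient graph of groups of the action of $\Gamma$ on $T$). Then the natural map $\delta\mathrm{Aut}(\mathbb X)\to\mathrm{Out}(\Gamma)$ is surjective.
   Context: A group $\Gamma$ acting without edge inversion on a tree $T$ with vertices coloured black and white (adjacent vertices having different colours, the action preserving colours) and abelian edge stabilizers is a piecewise trivial suspension over $T$ if: (1) black vertex stabilizers and edge stabilizers are free abelian of rank $2$; (2) for every white vertex $v$, the stabilizer is $\Gamma_v=G_v\times\langle t_v\rangle$ with $G_v$ a subgroup of $\Gamma$ with trivial centre and $\langle t_v\rangle$ infinite cyclic; (3) for every white vertex $v$, $t_v$ and its non-trivial powers fix exactly the ball of radius $2$ around $v$. If $\Gamma$ is a piecewise trivial suspension, the unique (up to isomorphism of $\Gamma$-trees) tree $T$ over which it is a piecewise trivial suspension is called its canonical structural tree. For a graph of groups $\mathbb X$ over $X$ with attaching maps $\tau_e:\mathbb X_e\to\mathbb X_{\tau(e)}$, $\delta\mathrm{Aut}(\mathbb X)$ is the group of tuples $(\phi_X,(\phi_v)_v,(\phi_e)_e,(\gamma_e)_e)$, where $\phi_X$ is an automorphism of the graph $X$, $\phi_v:\mathbb X_v\to\mathbb X_{\phi_X(v)}$ and $\phi_e=\phi_{\bar e}:\mathbb X_e\to\mathbb X_{\phi_X(e)}$ are isomorphisms and $\gamma_e\in\mathbb X_{\phi_X(\tau(e))}$, satisfying $\phi_{\tau(e)}\circ\tau_e=\mathrm{ad}_{\gamma_e}\circ\tau_{\phi_X(e)}\circ\phi_e$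 for every oriented edge $e$, with $\mathrm{ad}_\gamma(x)=\gamma^{-1}x\gamma$. Such a tuple acts on the Bass group (generated by vertex groups and oriented edges with relations $\bar e=e^{-1}$, $\tau_{\bar e}(g)e=e\tau_e(g)$) by $\phi_v$ on vertex groups and $e\mapsto\gamma_{\bar e}^{-1}\phi_X(e)\gamma_e$, inducing an isomorphism $\pi_1(\mathbb X,v)\to\pi_1(\mathbb X,\phi_X(v))$ and hence a well-defined element of $\mathrm{Out}(\pi_1(\mathbb X,v))=\mathrm{Out}(\Gamma)$.
   Formalization: The canonical structural tree T is additionally required to have no vertex of valence one (implied by minimality); without this T is not unique and the claim fails, e.g. for F_2 x Z acting on a star with black leaves F_2/<a>. *)

(* Defs.v *)
From HB Require Import structures.
From mathcomp Require Import all_boot all_algebra.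
From mathcomp Require Import boolp classical_sets functions.

Set Implicit Arguments.
Unset Strict Implicit.
Unset Printing Implicit Defensive.

Local Open Scope classical_set_scope.
Local Open Scope group_scope.

Section Groups.
Variable gT : groupType.
Implicit Types (H K : set gT) (x t : gT) (n : int).

Definition subgroup H := H 1 /\ forall x y, H x -> H y -> H (x / y).

Definition zexpg x n : gT :=
  match n with Posz m => x ^+ m | Negz m => x ^- m.+1 end.

Definition zcycle t : set gT := range (zexpg t).

Definition infinite_cyclic t := injective (zexpg t).

Definition set_abelian H := forall x y, H x -> H y -> x * y = y * x.

Definition trivial_centre H :=
  forall z, H z -> (forall x, H x -> z * x = x * z) -> z = 1.

Definition free_abelian_rank2 H :=
  exists f : int * int -> gT,
    [/\ forall u v, f (u + v)%R = f u * f v, injective f & range f = H].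

(* H is the internal direct product of its subgroups K and L. *)
Definition internal_direct_product H K L :=
  [/\ K `&` L = [set 1],
      forall x y, K x -> L y -> x * y = y * x
    & [set x * y | x in K & y in L] = H].

Definition morph_on (rT : groupType) H (f : gT -> rT) :=
  forall x y, H x -> H y -> f (x * y) = f x * f y.

End Groups.

(* Graphs in the sense of Serre: [erev] is the orientation reversal e |-> ebar,
   and [tgt e] is the terminal vertex tau(e). *)
Record graph := Graph {
  vert : Type;
  edge : Type;
  erev : edge -> edge;
  tgt : edge -> vert;
  erevK : involutive erev;
  erev_neq : forall e, erev e <> e
}.

Section GraphTheory.
Variable X : graph.
Implicit Types (x y : vert X) (e : edge X) (p : seq (edge X)).

Definition src e : vert X := tgt (erev e).

Fixpoint gpath x p y : Prop :=
  if p is e :: p' then src e = x /\ gpath (tgt e) p' y else x = y.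

Fixpoint reduced p : Prop :=
  if p is e :: p' then
    (if p' is e' :: _ then e' <> erev e else True) /\ reduced p'
  else True.

Definition is_tree :=
  [/\ inhabited (vert X),
      forall x y, exists p, gpath x p y
    & forall x p, gpath x p x -> reduced p -> p = [::]].

Definition gball x (r : nat) : set (vert X) :=
  [set y | exists2 p, gpath x p y & (size p <= r)%N].

Definition no_valence_one :=
  forall e, exists2 e', e' <> e & tgt e' = tgt e.

End GraphTheory.

(* Trees with a two-colouring of the vertices ([white x] or not, i.e. black)
   and a colour-preserving left action of gT without edge inversion. *)
Record coloured_tree (gT : groupType) := ColouredTree {
  tree_graph :> graph;
  tree_is_tree : is_tree tree_graph;
  white : vert tree_graph -> bool;
  white_adj : forall e, white (tgt e) = ~~ white (src e);
  actV : gT -> vert tree_graph -> vert tree_graph;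
  actE : gT -> edge tree_graph -> edge tree_graph;
  actV1 : forall x, actV 1 x = x;
  actVM : forall g h x, actV (g * h) x = actV g (actV h x);
  actE1 : forall e, actE 1 e = e;
  actEM : forall g h e, actE (g * h) e = actE g (actE h e);
  act_tgt : forall g e, tgt (actE g e) = actV g (tgt e);
  act_rev : forall g e, erev (actE g e) = actE g (erev e);
  act_noinv : forall g e, actE g e <> erev e;
  act_white : forall g x, white (actV g x) = white x
}.

Section PiecewiseTrivialSuspension.
Variables (gT : groupType) (T : coloured_tree gT).

Definition stabV (x : vert T) : set gT := [set g | actV g x = x].
Definition stabE (e : edge T) : set gT := [set g | actE g e = e].

Definition piecewise_trivial_suspension :=
  [/\ forall e, set_abelian (stabE e),
      forall x, ~~ white x -> free_abelian_rank2 (stabV x),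
      forall e, free_abelian_rank2 (stabE e)
    & forall v, white v -> exists (G : set gT) (t : gT),
        [/\ subgroup G, trivial_centre G, infinite_cyclic t,
            internal_direct_product (stabV v) G (zcycle t)
          & forall n : int, n <> 0%R ->
              [set x | actV (zexpg t n) x = x] = gball v 2]].

(* The structural tree is unique up to isomorphism of gT-trees once vertices of
   valence one are excluded; this holds in particular for minimal actions.
   Otherwise, e.g. F_2 x Z with F_2 free on a, b is a piecewise trivial
   suspension over a single white vertex, but also over the star with one
   white centre and the black leaves F_2/<a>, with leaf and edge stabilizers
   the conjugates of <a> x Z. *)
Definition canonical_structural_tree :=
  piecewise_trivial_suspension /\ no_valence_one T.

End PiecewiseTrivialSuspension.

(* Graphs of groups. As for finite groups in MathComp, the vertex and edge
   groups are subgroups of an ambient group, and homomorphisms between them are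
   functions on the ambient group of which only the values on the subgroup
   matter. For the graph of groups dual to a tree, the ambient group is the
   group acting on the tree. *)
Record gog (gT : groupType) := Gog {
  gog_graph :> graph;
  gV : vert gog_graph -> set gT;
  gE : edge gog_graph -> set gT;
  att : edge gog_graph -> gT -> gT;
  gV_subgroup : forall v, subgroup (gV v);
  gE_subgroup : forall e, subgroup (gE e);
  gE_rev : forall e, gE (erev e) = gE e;
  att_fun : forall e, set_fun (gE e) (gV (tgt e)) (att e);
  att_morph : forall e, morph_on (gE e) (att e);
  att_inj : forall e, set_inj (gE e) (att e)
}.

Section BassGroup.
Variables (gT : groupType) (X : gog gT).

Inductive bletter :=
  | Vletter (v : vert X) g of gV v g
  | Eletter of edge X.

HB.instance Definition _ := gen_eqMixin bletter.
HB.instance Definition _ := gen_choiceMixin bletter.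

Notation bword := (seq bletter).

Lemma gV1 (v : vert X) : gV v 1.
Proof. by case: (gV_subgroup v). Qed.

Lemma gVF (v : vert X) g h : gV v g -> gV v h -> gV v (g / h).
Proof. by case: (gV_subgroup v) => _; apply. Qed.

Lemma gVV (v : vert X) g : gV v g -> gV v g^-1.
Proof. by move=> gv; rewrite -div1g; apply: gVF => //; apply: gV1. Qed.

Lemma gVM (v : vert X) g h : gV v g -> gV v h -> gV v (g * h).
Proof. by move=> gv hv; rewrite -[h]invgK; apply: gVF => //; apply: gVV. Qed.

Lemma att_src (e : edge X) y : gE e y -> gV (src e) (att (erev e) y).
Proof. by move=> ye; apply: att_fun; rewrite gE_rev. Qed.

Inductive brel : bword -> bword -> Prop :=
  | brel_1 (v : vert X) (v1 : gV v 1) : brel [:: Vletter v1] [::]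
  | brel_M (v : vert X) g h (gv : gV v g) (hv : gV v h) (ghv : gV v (g * h)) :
      brel [:: Vletter gv; Vletter hv] [:: Vletter ghv]
  | brel_rev (e : edge X) : brel [:: Eletter e; Eletter (erev e)] [::]
  | brel_att (e : edge X) y (ye : gE e y) :
      brel [:: Vletter (att_src ye); Eletter e]
           [:: Eletter e; Vletter (att_fun ye)].

Inductive bcong : bword -> bword -> Prop :=
  | bcong_rel a w1 w2 b :
      brel w1 w2 -> bcong (a ++ w1 ++ b) (a ++ w2 ++ b)
  | bcong_refl w : bcong w w
  | bcong_sym w1 w2 : bcong w1 w2 -> bcong w2 w1
  | bcong_trans w1 w2 w3 : bcong w1 w2 -> bcong w2 w3 -> bcong w1 w3.

Definition bcongb : rel bword := fun w1 w2 => `[< bcong w1 w2 >].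

Lemma bcongb_equiv : equiv_class_of bcongb.
Proof.
split=> [w|w1 w2|w2 w1 w3]; first by apply/asboolP; apply: bcong_refl.
  by apply/asboolP/asboolP; apply: bcong_sym.
by move=> /asboolP c12 /asboolP c23; apply/asboolP; apply: bcong_trans c23.
Qed.

Canonical bcong_equiv := EquivRelPack bcongb_equiv.

Definition bassGroup := {eq_quot bcong_equiv}%qT.

HB.instance Definition _ := Choice.on bassGroup.

Definition bclass (w : bword) : bassGroup := (\pi_(bassGroup) w)%qT.

Lemma bclassP w1 w2 : bclass w1 = bclass w2 <-> bcong w1 w2.
Proof.
split; first by move/eqmodP => /asboolP.
by move=> c; apply/eqmodP/asboolP.
Qed.

Lemma bclass_repr (x : bassGroup) : bclass (repr x) = x.
Proof. by rewrite /bclass reprK. Qed.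

Lemma bcong_cat w1 w2 w1' w2' :
  bcong w1 w1' -> bcong w2 w2' -> bcong (w1 ++ w2) (w1' ++ w2').
Proof.
move=> c1 c2; apply: (@bcong_trans _ (w1 ++ w2')).
  elim: c2 => [a u1 u2 b r|||].
  - by have := bcong_rel (w1 ++ a) b r; rewrite -!catA.
  - by move=> w; apply: bcong_refl.
  - by move=> u1 u2 _; apply: bcong_sym.
  - by move=> u1 u2 u3 _ h1 _; apply: bcong_trans.
elim: c1 => [a u1 u2 b r|||].
- by have := bcong_rel a (b ++ w2') r; rewrite -!catA.
- by move=> w; apply: bcong_refl.
- by move=> u1 u2 _; apply: bcong_sym.
- by move=> u1 u2 u3 _ h1 _; apply: bcong_trans.
Qed.

Definition linv (l : bletter) : bletter :=
  match l with
  | Vletter v g gv => Vletter (gVV gv)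
  | Eletter e => Eletter (erev e)
  end.

Definition winv (w : bword) : bword := rev (map linv w).

Lemma Vletter_irr (v : vert X) g (p q : gV v g) : Vletter p = Vletter q.
Proof. by congr Vletter; apply: Prop_irrelevance. Qed.

Lemma linvK : involutive linv.
Proof.
case=> [v g gv|e] /=; last by rewrite erevK.
by move: (gVV _); rewrite invgK => p; apply: Vletter_irr.
Qed.

Lemma winvK : involutive winv.
Proof. by move=> w; rewrite /winv map_rev revK mapK //; apply: linvK. Qed.

Lemma bcong_mulV1 l : bcong [:: l; linv l] [::].
Proof.
case: l => [v g gv|e] /=; last exact: (bcong_rel [::] [::] (brel_rev e)).
have ggv : gV v (g * g^-1) by apply: gVM => //; apply: gVV.
apply: bcong_trans (bcong_rel [::] [::] (brel_M gv (gVV gv) ggv)) _.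
by move: ggv; rewrite mulgV => p; apply: (bcong_rel [::] [::] (brel_1 p)).
Qed.

Lemma bcong_mulV w : bcong (w ++ winv w) [::].
Proof.
elim: w => [|l w IH]; first exact: bcong_refl.
rewrite /winv /= rev_cons -cats1 catA.
apply: (@bcong_trans _ ([:: l] ++ [::] ++ [:: linv l])); last first.
  exact: bcong_mulV1.
by apply: (bcong_cat (bcong_refl [:: l])); apply: bcong_cat => //;
   apply: bcong_refl.
Qed.

Definition bmul (x y : bassGroup) : bassGroup := bclass (repr x ++ repr y).
Definition binv (x : bassGroup) : bassGroup := bclass (winv (repr x)).

Lemma bmul_class w1 w2 : bmul (bclass w1) (bclass w2) = bclass (w1 ++ w2).
Proof. by apply/bclassP; apply: bcong_cat; apply/bclassP/bclass_repr. Qed.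

Lemma bmulA : associative bmul.
Proof.
move=> x y z; rewrite -[x]bclass_repr -[y]bclass_repr -[z]bclass_repr.
by rewrite !bmul_class catA.
Qed.

Lemma bmul1 : left_id (bclass [::]) bmul.
Proof. by move=> x; rewrite -[x]bclass_repr bmul_class. Qed.

Lemma bmulr1 : right_id (bclass [::]) bmul.
Proof. by move=> x; rewrite -[x]bclass_repr bmul_class cats0. Qed.

Lemma bmulV : right_inverse (bclass [::]) binv bmul.
Proof.
move=> x; rewrite -{1}[x]bclass_repr /binv bmul_class.
by apply/bclassP; apply: bcong_mulV.
Qed.

Lemma bmulVl : left_inverse (bclass [::]) binv bmul.
Proof.
move=> x; rewrite -{2}[x]bclass_repr /binv bmul_class.
by apply/bclassP; rewrite -{2}[repr x]winvK; apply: bcong_mulV.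
Qed.

HB.instance Definition _ :=
  isGroup.Build bassGroup bmulA bmul1 bmulr1 bmulVl bmulV.

End BassGroup.

Section BassGroupTheory.
Variables (gT : groupType) (X : gog gT).

Definition bV (v : vert X) g (gv : gV v g) : bassGroup X :=
  bclass [:: Vletter gv].
Definition bE (e : edge X) : bassGroup X := bclass [:: Eletter e].

Lemma bclass_cat (w1 w2 : seq (bletter X)) :
  bclass (w1 ++ w2) = bclass w1 * bclass w2.
Proof. by rewrite -bmul_class. Qed.

Lemma bclass_nil : bclass [::] = 1 :> bassGroup X.
Proof. by []. Qed.

Lemma bV_irr (v : vert X) g (p q : gV v g) : bV p = bV q.
Proof. by congr bV; apply: Prop_irrelevance. Qed.

Lemma bV_eq (v : vert X) g h (p : gV v g) (q : gV v h) : g = h -> bV p = bV q.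
Proof. by move=> gh; move: p; rewrite gh => p; apply: bV_irr. Qed.

Lemma bV_eq2 (v w : vert X) g h (p : gV v g) (q : gV w h) :
  v = w -> g = h -> bV p = bV q.
Proof. by move=> vw; move: p; rewrite vw => p; apply: bV_eq. Qed.

Lemma bclass_rel (w1 w2 : seq (bletter X)) : brel w1 w2 -> bclass w1 = bclass w2.
Proof.
by move=> r; apply/bclassP; have := bcong_rel [::] [::] r; rewrite !cats0.
Qed.

Lemma bV1 (v : vert X) (p : gV v 1) : bV p = 1.
Proof. exact: bclass_rel (brel_1 p). Qed.

Lemma bVM (v : vert X) g h (p : gV v g) (q : gV v h) (r : gV v (g * h)) :
  bV r = bV p * bV q.
Proof. by rewrite /bV -bclass_cat -(bclass_rel (brel_M p q r)). Qed.

Lemma bVV (v : vert X) g (p : gV v g) (q : gV v g^-1) : bV q = (bV p)^-1.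
Proof.
apply/esym/mulg1_eq; rewrite -(bVM p q (gVM p q)).
by rewrite (bV_eq _ (gV1 v)) ?mulgV// bV1.
Qed.

Lemma bE_erev (e : edge X) : bE (erev e) = (bE e)^-1.
Proof. by apply/esym/mulg1_eq; rewrite /bE -bclass_cat (bclass_rel (brel_rev e)). Qed.

Lemma bE_att (e : edge X) y (ye : gE e y) :
  bV (att_src ye) * bE e = bE e * bV (att_fun ye).
Proof. by rewrite /bV /bE -!bclass_cat (bclass_rel (brel_att ye)). Qed.

(* The elements of the Bass group carried by the paths from u to w, that is
   the products g0 e1 g1 ... en gn where e1 ... en is a path from u to w, and
   where gi lies in the group of the i-th vertex of that path. *)
Inductive bpath : vert X -> bassGroup X -> vert X -> Prop :=
  | bpath_vert u g (gu : gV u g) : bpath u (bV gu) u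
  | bpath_edge e g (ge : gV (src e) g) x w :
      bpath (tgt e) x w -> bpath (src e) (bV ge * bE e * x) w.

Definition pi1 (v : vert X) : set (bassGroup X) := [set x | bpath v x v].

Section Lift.
Variables (rT : groupType) (f : bletter X -> rT).

Definition bletter_eval (w : seq (bletter X)) : rT := \prod_(l <- w) f l.

Hypothesis f_rel :
  forall w1 w2, brel w1 w2 -> bletter_eval w1 = bletter_eval w2.

Definition bass_lift (x : bassGroup X) : rT := bletter_eval (repr x).

Lemma bletter_eval_cong w1 w2 :
  bcong w1 w2 -> bletter_eval w1 = bletter_eval w2.
Proof.
elim=> [a u1 u2 b /f_rel r|//|u1 u2 _ -> //|u1 u2 u3 _ -> _ -> //].
by rewrite /bletter_eval !big_cat -!/(bletter_eval _) r.
Qed.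

Lemma bass_lift_class w : bass_lift (bclass w) = bletter_eval w.
Proof. by apply/bletter_eval_cong/bclassP/bclass_repr. Qed.

Lemma bass_liftM : {morph bass_lift : x y / x * y}.
Proof.
move=> x y; rewrite -[x]bclass_repr -[y]bclass_repr -bclass_cat.
by rewrite !bass_lift_class /bletter_eval big_cat.
Qed.

Lemma bass_liftV (v : vert X) g (gv : gV v g) : bass_lift (bV gv) = f (Vletter gv).
Proof. by rewrite bass_lift_class /bletter_eval big_seq1. Qed.

Lemma bass_liftE (e : edge X) : bass_lift (bE e) = f (Eletter e).
Proof. by rewrite bass_lift_class /bletter_eval big_seq1. Qed.

Lemma bass_lift1 : bass_lift 1 = 1.
Proof. by apply: (mulgI (bass_lift 1)); rewrite -bass_liftM !mulg1. Qed.

Lemma bass_lift_inv x : bass_lift x^-1 = (bass_lift x)^-1.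
Proof. by apply/esym/mulg1_eq; rewrite -bass_liftM mulgV bass_lift1. Qed.

End Lift.

Lemma bass_ind (P : bassGroup X -> Prop) :
  P 1 -> (forall x y, P x -> P y -> P (x * y)) ->
  (forall (v : vert X) g (gv : gV v g), P (bV gv)) ->
  (forall e : edge X, P (bE e)) -> forall x, P x.
Proof.
move=> P1 PM PV PE x; rewrite -[x]bclass_repr.
elim: (repr x) => [|l w IH]; first exact: P1.
by rewrite -cat1s bclass_cat; apply: PM => //; case: l.
Qed.

Lemma bpath_mull (u w : vert X) g (gu : gV u g) x :
  bpath u x w -> bpath u (bV gu * x) w.
Proof.
move=> b; case: _ / b gu => [u' h hu|e h he y w' b] gu.
  by rewrite -(bVM gu hu (gVM gu hu)); apply: bpath_vert.
by rewrite !mulgA -(bVM gu he (gVM gu he)); apply: bpath_edge.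
Qed.

Lemma bpath_mul (u v w : vert X) x y :
  bpath u x v -> bpath v y w -> bpath u (x * y) w.
Proof.
move=> b; elim: b y w => [u' h hu|e h he z w' _ IH] y w b.
  exact: bpath_mull.
by rewrite -!mulgA mulgA; apply: bpath_edge; apply: IH.
Qed.

End BassGroupTheory.

Record graph_aut (X : graph) := GraphAut {
  autV : vert X -> vert X;
  autE : edge X -> edge X;
  autV_bij : bijective autV;
  autE_bij : bijective autE;
  aut_tgt : forall e, tgt (autE e) = autV (tgt e);
  aut_rev : forall e, autE (erev e) = erev (autE e)
}.

Lemma aut_src (X : graph) (f : graph_aut X) e : src (autE f e) = autV f (src e).
Proof. by rewrite /src -aut_rev aut_tgt. Qed.

(* Here x ^ g is g^-1 * x * g, that is ad_g(x). *)
Record deltaAut (gT : groupType) (X : gog gT) := DeltaAut {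
  dX :> graph_aut X;
  dV : vert X -> gT -> gT;
  dE : edge X -> gT -> gT;
  dgamma : edge X -> gT;
  dV_morph : forall v, morph_on (gV v) (dV v);
  dV_bij : forall v, set_bij (gV v) (gV (autV dX v)) (dV v);
  dE_morph : forall e, morph_on (gE e) (dE e);
  dE_bij : forall e, set_bij (gE e) (gE (autE dX e)) (dE e);
  dE_rev : forall e, {in gE e, dE (erev e) =1 dE e};
  dgammaP : forall e, gV (autV dX (tgt e)) (dgamma e);
  dAtt : forall e x, gE e x ->
    dV (tgt e) (att e x) = att (autE dX e) (dE e x) ^ dgamma e
}.

Section DeltaAutBass.
Variables (gT : groupType) (X : gog gT) (D : deltaAut X).

Lemma dV_fun (v : vert X) g : gV v g -> gV (autV D v) (dV D v g).
Proof. by case: (dV_bij D v) => + _ _; apply. Qed.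

Lemma dE_fun (e : edge X) g : gE e g -> gE (autE D e) (dE D e g).
Proof. by case: (dE_bij D e) => + _ _; apply. Qed.

Lemma dV1 (v : vert X) : dV D v 1 = 1.
Proof.
apply: (mulgI (dV D v 1)); rewrite mulg1.
by rewrite -(dV_morph D (gV1 v) (gV1 v)) mulg1.
Qed.

Definition dgammab e : bassGroup X := bV (dgammaP D e).

Definition delta_letter (l : bletter X) : bassGroup X :=
  match l with
  | Vletter v g gv => bV (dV_fun gv)
  | Eletter e => (dgammab (erev e))^-1 * bE (autE D e) * dgammab e
  end.

Lemma delta_att (e : edge X) y (ye : gE e y) :
  bV (dV_fun (att_fun ye)) =
    bV (att_fun (dE_fun ye)) ^ dgammab e.
Proof.
have p : gV (autV D (tgt e)) (att (autE D e) (dE D e y)).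
  by rewrite -aut_tgt; apply/att_fun/dE_fun.
rewrite (bV_eq2 (att_fun (dE_fun ye)) p)// ?aut_tgt//.
have d := dgammaP D e; rewrite /dgammab (bV_irr (dgammaP D e) d) conjgE.
rewrite -(bVV d (gVV d)) -(bVM p d (gVM p d)).
rewrite -(bVM (gVV d) (gVM p d) (gVM (gVV d) (gVM p d))).
by apply: bV_eq; rewrite dAtt.
Qed.

Lemma delta_rel w1 w2 :
  brel w1 w2 -> bletter_eval delta_letter w1 = bletter_eval delta_letter w2.
Proof.
rewrite /bletter_eval; case=> [v v1|v g h gv hv ghv|e|e y ye].
- by rewrite big_seq1 big_nil /=; move: (dV_fun v1); rewrite dV1; apply: bV1.
- rewrite big_cons !big_seq1 /= -(bVM _ _ (gVM (dV_fun gv) (dV_fun hv))).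
  by apply: bV_eq; rewrite dV_morph.
- rewrite big_cons big_seq1 big_nil /= erevK aut_rev bE_erev.
  by rewrite !mulgA mulgK mulgK mulVg.
- rewrite !big_cons !big_nil /= !mulg1.
  have yr : gE (erev e) y by rewrite gE_rev.
  have -> : bV (dV_fun (att_src ye)) = bV (dV_fun (att_fun yr)).
    exact: bV_irr.
  rewrite !delta_att !conjgE !mulgA mulgK; congr (_ * _).
  rewrite mulgK -!mulgA; congr (_ * _).
  have -> : bV (att_fun (dE_fun yr)) =
            bV (att_src (dE_fun ye)) :> bassGroup X.
    by apply: bV_eq2; rewrite ?aut_rev// dE_rev ?inE.
  exact: bE_att.
Qed.

Definition delta_bass : bassGroup X -> bassGroup X := bass_lift delta_letter.
End DeltaAutBass.

Section DeltaAutPaths.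
Variables (gT : groupType) (X : gog gT) (D : deltaAut X).
Local Notation DX := (delta_bass D).

Lemma delta_bassM : {morph DX : x y / x * y}.
Proof. exact/bass_liftM/delta_rel. Qed.

HB.instance Definition _ := isMultiplicative.Build _ _ DX delta_bassM.

Lemma delta_bass1 : DX 1 = 1.
Proof. by apply: (mulgI (DX 1)); rewrite -delta_bassM !mulg1. Qed.

Lemma delta_bassV (v : vert X) g (gv : gV v g) : DX (bV gv) = bV (dV_fun D gv).
Proof. exact/bass_liftV/delta_rel. Qed.

Lemma delta_bassE (e : edge X) :
  DX (bE e) = (dgammab D (erev e))^-1 * bE (autE D e) * dgammab D e.
Proof. exact/bass_liftE/delta_rel. Qed.

Lemma bpath_edge_eq (u : vert X) (e : edge X) g (gu : gV u g) x w :
  u = src e -> bpath (tgt e) x w -> bpath u (bV gu * bE e * x) w.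
Proof. by move=> ue; move: gu; rewrite ue => gu; apply: bpath_edge. Qed.

Lemma delta_bpath u x w : bpath u x w -> bpath (autV D u) (DX x) (autV D w).
Proof.
elim=> [{}u g gu|e g ge {}x {}w b IH].
  by rewrite delta_bassV; apply: bpath_vert.
rewrite !delta_bassM delta_bassV delta_bassE -!mulgA mulgA.
have p := dgammaP D (erev e).
rewrite /dgammab (bV_irr (dgammaP D (erev e)) p) -(bVV p (gVV p)).
rewrite -(bVM (dV_fun D ge) (gVV p) (gVM (dV_fun D ge) (gVV p))) mulgA.
apply: bpath_edge_eq; first by rewrite aut_src.
by rewrite aut_tgt; apply: bpath_mull.
Qed.

Lemma delta_bpath_surj u' x' w' : bpath u' x' w' ->
  forall u w, u' = autV D u -> w' = autV D w ->
  exists2 x, bpath u x w & DX x = x'.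
Proof.
have vinj := bij_inj (autV_bij D).
have dsurj v g : gV (autV D v) g -> exists2 h, gV v h & dV D v h = g.
  by case: (dV_bij D v) => _ _ s /s.
elim=> [{}u' g gu|e' g ge {}x' {}w' b IH] u w eu ew.
  have /vinj wu := etrans (esym ew) eu; rewrite {}wu {w ew}.
  have [h hu hg] : exists2 h, gV u h & dV D u h = g.
    by apply: dsurj; rewrite -eu.
  by exists (bV hu); [apply: bpath_vert|rewrite delta_bassV; apply: bV_eq2].
have [e ee'] : exists e, e' = autE D e.
  by case: (autE_bij D) => f _ fK; exists (f e').
subst e'; have uE : u = src e by apply: vinj; rewrite -eu aut_src.
subst u; have [|x bx Dx] := IH (tgt e) w _ ew; first by rewrite aut_tgt.
have q := dgammaP D (erev e); have r := gVV (dgammaP D e).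
have ge' : gV (autV D (src e)) g by rewrite -aut_src.
have [h hu hg] := dsurj _ _ (gVM ge' q).
have [k ku kg] := dsurj _ _ r.
exists (bV hu * bE e * (bV ku * x)).
  by apply: bpath_edge => //; apply: bpath_mull.
rewrite !delta_bassM !delta_bassV delta_bassE Dx mulgA; congr (_ * _).
rewrite (bV_eq (dV_fun D hu) (gVM ge' q))// (bVM ge' q).
rewrite (bV_eq (dV_fun D ku) r)// (bVV (dgammaP D e)).
rewrite /dgammab (bV_irr (dgammaP D (erev e)) q).
by rewrite !mulgA !mulgK; congr (_ * _); apply: bV_eq2; rewrite ?aut_src.
Qed.

Lemma delta_bass_inj : injective DX.
Proof.
have [vI vK Kv] := autV_bij D; have [eI eK Ke] := autE_bij D.
have tI e : vI (tgt e) = tgt (eI e).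
  by apply: (can_inj vK); rewrite Kv -aut_tgt Ke.
have rI e : eI (erev e) = erev (eI e).
  by apply: (can_inj eK); rewrite Ke aut_rev Ke.
have inv v g (gv : gV v g) : {h | gV (vI v) h /\ dV D (vI v) h = g}.
  apply: cid; case: (dV_bij D (vI v)) => _ _ /(_ g).
  by rewrite Kv => /(_ gv)[h hv hg]; exists h.
pose psiV v g (gv : gV v g) := bV (proj1 (svalP (inv v g gv))).
have psiV_eq v w g h (gv : gV v g) (hw : gV w h) :
    v = autV D w -> g = dV D w h -> psiV v g gv = bV hw.
  move=> vw gh; have wv : vI v = w by rewrite vw vK.
  apply: bV_eq2 => //; case: (inv _ _ _) => k /= [].
  rewrite wv => kw kg; case: (dV_bij D w) => _ + _.
  by move/(_ k h); apply; rewrite ?inE// kg.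
have psiV_irr v w g h (gv : gV v g) (hw : gV w h) :
    v = w -> g = h -> psiV v g gv = psiV w h hw.
  move=> vw gh; subst w h; congr psiV; exact: Prop_irrelevance.
have psiVM v g h (gv : gV v g) (hv : gV v h) (ghv : gV v (g * h)) :
    psiV v _ ghv = psiV v _ gv * psiV v _ hv.
  rewrite /psiV; case: (inv _ _ gv) => g' /= [g'v g'E].
  case: (inv _ _ hv) => h' /= [h'v h'E].
  rewrite (bV_irr (proj1 _) g'v) (bV_irr (proj1 _) h'v).
  rewrite -(bVM g'v h'v (gVM g'v h'v)); apply: psiV_eq; first by rewrite Kv.
  by rewrite dV_morph// g'E h'E.
have psiV1 v (v1 : gV v 1) : psiV v _ v1 = 1.
  rewrite -(bV1 (gV1 (vI v))); apply: psiV_eq; first by rewrite Kv.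
  by rewrite dV1.
pose c e := psiV _ _ (dgammaP D e).
have psi_att e y (ye : gE e y) (z : gV _ (att (autE D e) (dE D e y))) :
    psiV (tgt (autE D e)) _ z = c e * bV (att_fun ye) * (c e)^-1.
  apply: (canRL (mulgK _)); rewrite /c.
  have z' : gV (autV D (tgt e)) (att (autE D e) (dE D e y)).
    by rewrite -aut_tgt.
  have d := dgammaP D e; rewrite (psiV_irr _ _ _ _ z z')// ?aut_tgt//.
  rewrite -(psiV_eq _ _ _ _ (dV_fun D (att_fun ye)) (att_fun ye))//.
  rewrite -(psiVM _ _ _ _ _ (gVM z' d)).
  rewrite -(psiVM _ _ _ _ _ (gVM d (dV_fun D (att_fun ye)))).
  by apply: psiV_irr => //; rewrite dAtt// -conjgC.
pose psi (l : bletter X) : bassGroup X :=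
  match l with
  | Vletter v g gv => psiV v g gv
  | Eletter e => c (erev (eI e)) * bE (eI e) * (c (eI e))^-1
  end.
have psi_rel w1 w2 : brel w1 w2 -> bletter_eval psi w1 = bletter_eval psi w2.
  rewrite /bletter_eval; case=> [v v1|v g h gv hv ghv|e|e y ye].
  - by rewrite big_seq1 big_nil /= psiV1.
  - by rewrite big_cons !big_seq1 /= -psiVM.
  - rewrite big_cons big_seq1 big_nil /= rI erevK bE_erev.
    by rewrite !mulgA mulgVK mulgK mulgV.
  - rewrite !big_cons !big_nil /= !mulg1.
    have [e' ee'] : exists e', e = autE D e' by exists (eI e); rewrite Ke.
    subst e; have [y' ye' yy'] : exists2 y', gE e' y' & dE D e' y' = y.
      by case: (dE_bij D e') => _ _ /(_ y ye).
    subst y; have ye'r : gE (erev e') y' by rewrite gE_rev.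
    have zr : gV (tgt (autE D (erev e')))
                (att (autE D (erev e')) (dE D (erev e') y')).
      exact/att_fun/dE_fun.
    rewrite (psiV_irr _ _ _ _ (att_src ye) zr) ?aut_rev//; last first.
      by rewrite dE_rev ?inE.
    rewrite (psi_att _ _ ye'r) (psi_att _ _ ye') eK !mulgA !mulgVK.
    rewrite -!mulgA; congr (_ * _); rewrite !mulgA; congr (_ * _).
    by rewrite -bE_att; congr (_ * _); apply: bV_irr.
have psiK x : bass_lift psi (DX x) = x.
  elim/bass_ind: x => [|x y IHx IHy|v g gv|e].
  - by rewrite delta_bass1 -bclass_nil bass_lift_class// /bletter_eval big_nil.
  - by rewrite delta_bassM bass_liftM// IHx IHy.
  - by rewrite delta_bassV bass_liftV//=; apply: psiV_eq.
  - rewrite delta_bassE !bass_liftM// bass_liftE//= eK.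
    by rewrite bass_lift_inv// !bass_liftV//= !mulgA mulVg mul1g mulgVK.
exact: can_inj psiK.
Qed.

End DeltaAutPaths.

(* The quotient graph of gT acting on T, given by an arbitrary graph with a
   projection whose fibres are the orbits, together with the choices entering
   the definition of the quotient graph of groups: a lift of each vertex and
   of each edge, and for each edge e an element carrying the lift of tau(e)
   to the terminal vertex of the lift of e. *)
Record quotient_data (gT : groupType) (T : coloured_tree gT) := QuotientData {
  qgraph : graph;
  qV : vert T -> vert qgraph;
  qE : edge T -> edge qgraph;
  q_tgt : forall e, qV (tgt e) = tgt (qE e);
  q_rev : forall e, qE (erev e) = erev (qE e);
  qVP : forall x y, qV x = qV y <-> exists g, y = actV g x;
  qEP : forall e f, qE e = qE f <-> exists g, f = actE g e;
  liftV : vert qgraph -> vert T;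
  liftE : edge qgraph -> edge T;
  liftVK : cancel liftV qV;
  liftEK : cancel liftE qE;
  liftE_rev : forall e, liftE (erev e) = erev (liftE e);
  lift_elt : edge qgraph -> gT;
  lift_eltP : forall e, actV (lift_elt e) (liftV (tgt e)) = tgt (liftE e)
}.

Section Actions.
Variables (gT : groupType) (T : coloured_tree gT).

Lemma actVK (g : gT) : cancel (actV (c := T) g) (actV g^-1).
Proof. by move=> x; rewrite -actVM mulVg actV1. Qed.

Lemma actVKV (g : gT) : cancel (actV (c := T) g^-1) (actV g).
Proof. by move=> x; rewrite -actVM mulgV actV1. Qed.

Lemma actEK (g : gT) : cancel (actE (c := T) g) (actE g^-1).
Proof. by move=> x; rewrite -actEM mulVg actE1. Qed.

Lemma actEKV (g : gT) : cancel (actE (c := T) g^-1) (actE g).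
Proof. by move=> x; rewrite -actEM mulgV actE1. Qed.

Lemma act_src (g : gT) (e : edge T) : src (actE g e) = actV g (src e).
Proof. by rewrite /src act_rev act_tgt. Qed.

Lemma stabV_subgroup (x : vert T) : subgroup (stabV x).
Proof.
split=> [|g h gx hx]; first exact: actV1.
by rewrite /stabV /= actVM -{1}hx actVK.
Qed.

Lemma stabE_subgroup (e : edge T) : subgroup (stabE e).
Proof.
split=> [|g h ge he]; first exact: actE1.
by rewrite /stabE /= actEM -{1}he actEK.
Qed.

Lemma stabE_erev (e : edge T) : stabE (erev e) = stabE e.
Proof.
apply/seteqP; split=> g; rewrite /stabE /= -act_rev; last by move=> ->.
by apply: (can_inj (@erevK T)).
Qed.

Lemma stabE_tgt (e : edge T) g : stabE e g -> stabV (tgt e) g.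
Proof. by move=> ge; rewrite /stabV /= -act_tgt ge. Qed.

End Actions.

Section DualGraphOfGroups.
Variables (gT : groupType) (T : coloured_tree gT) (Q : quotient_data T).

Lemma dual_att_fun (e : edge (qgraph Q)) :
  set_fun (stabE (liftE e)) (stabV (liftV (tgt e)))
    (fun x => x ^ lift_elt e).
Proof.
move=> x /stabE_tgt; rewrite -lift_eltP /stabV /= conjgE !actVM => ->.
exact: actVK.
Qed.

Lemma dual_att_inj (e : edge (qgraph Q)) :
  set_inj (stabE (liftE e)) (fun x => x ^ lift_elt e).
Proof. by move=> x y _ _; apply: conjg_inj. Qed.

Lemma dual_att_morph (e : edge (qgraph Q)) :
  morph_on (stabE (liftE e)) (fun x => x ^ lift_elt e).
Proof. by move=> x y _ _; apply: conjMg. Qed.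

Lemma dual_gE_rev (e : edge (qgraph Q)) :
  stabE (liftE (erev e)) = stabE (liftE e).
Proof. by rewrite liftE_rev stabE_erev. Qed.

Definition dual_gog : gog gT :=
  @Gog gT (qgraph Q) (fun v => stabV (liftV v)) (fun e => stabE (liftE e))
    (fun e x => x ^ lift_elt e)
    (fun v => stabV_subgroup _) (fun e => stabE_subgroup _)
    dual_gE_rev dual_att_fun dual_att_morph dual_att_inj.

Definition dual_letter (l : bletter dual_gog) : gT :=
  match l with
  | Vletter v g gv => g
  | Eletter e => (lift_elt (erev e))^-1 * lift_elt e
  end.

Lemma dual_letter_rel w1 w2 : brel w1 w2 ->
  bletter_eval dual_letter w1 = bletter_eval dual_letter w2.
Proof.
rewrite /bletter_eval; case=> [v v1|v g h gv hv ghv|e|e y ye].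
- by rewrite big_seq1 big_nil.
- by rewrite big_cons !big_seq1.
- by rewrite big_cons big_seq1 big_nil /= erevK !mulgA mulgK mulVg.
- rewrite !big_cons !big_nil /= !mulg1 !conjgE.
  by rewrite !mulgA !mulgK.
Qed.

(* The restriction to the fundamental group at any vertex is the Bass-Serre
   isomorphism with gT: see [dual_eval_surj] and [dual_eval_pi1_inj]. *)
Definition dual_eval : bassGroup dual_gog -> gT := bass_lift dual_letter.

Lemma dual_evalM : {morph dual_eval : x y / x * y}.
Proof. exact/bass_liftM/dual_letter_rel. Qed.

HB.instance Definition _ := isMultiplicative.Build _ _ dual_eval dual_evalM.

Lemma dual_evalV (v : vert dual_gog) g (gv : gV v g) : dual_eval (bV gv) = g.
Proof. exact/bass_liftV/dual_letter_rel. Qed.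

Lemma dual_evalE (e : edge dual_gog) :
  dual_eval (bE e) = (lift_elt (erev e))^-1 * lift_elt e.
Proof. exact/bass_liftE/dual_letter_rel. Qed.

Lemma lift_eltP_src (e : edge (qgraph Q)) :
  actV (lift_elt (erev e)) (liftV (src e)) = src (liftE e).
Proof. by rewrite lift_eltP liftE_rev. Qed.

Lemma q_src (e : edge T) : qV Q (src e) = src (qE Q e).
Proof. by rewrite /src q_tgt q_rev. Qed.

Lemma lift_orbitV (x : vert T) : exists g, x = actV g (liftV (qV Q x)).
Proof. by apply/(qVP Q); rewrite liftVK. Qed.

Lemma lift_orbitE (e : edge T) : exists g, e = actE g (liftE (qE Q e)).
Proof. by apply/(qEP Q); rewrite liftEK. Qed.

Lemma dual_eval_surj_path p (x y : vert T) : gpath x p y ->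
  forall (u w : vert dual_gog) g k, x = actV g (liftV u) -> y = actV k (liftV w) ->
  exists2 z : bassGroup dual_gog, bpath u z w & dual_eval z = g^-1 * k.
Proof.
elim: p x => [|E p IH] x /=.
  move=> <-{y} u w g k xu xw.
  have uw : u = w.
    have : qV Q (liftV u) = qV Q (liftV w).
      by apply/(qVP Q); exists (k^-1 * g); rewrite actVM -xu xw actVK.
    by rewrite !liftVK.
  subst w; have gk : gV (u : vert dual_gog) (g^-1 * k).
    by rewrite /= /stabV /= actVM -xw xu actVK.
  by exists (bV gk); [apply: bpath_vert|rewrite dual_evalV].
move=> [sE pE] u w g k xu yw.
have [m Em] := lift_orbitE E; set e := qE Q E in Em.
have ue : u = src e.
  have : qV Q (liftV u) = qV Q (src E).
    by apply/(qVP Q); exists g; rewrite sE.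
  by rewrite (liftVK (q := Q)) q_src.
have tE : tgt E = actV (m * lift_elt e) (liftV (tgt e)).
  by rewrite actVM lift_eltP Em act_tgt.
have [z bz ez] := IH _ pE _ _ _ _ tE yw.
subst u; have ag : gV (src e : vert dual_gog) (g^-1 * (m * lift_elt (erev e))).
  rewrite /= /stabV /= !actVM lift_eltP_src -act_src -Em sE xu.
  exact: actVK.
exists (bV ag * bE (e : edge dual_gog) * z); first exact: bpath_edge.
rewrite !dual_evalM dual_evalV dual_evalE ez invgM !mulgA.
by rewrite !mulgK.
Qed.

Lemma dual_eval_surj v g :
  exists2 z : bassGroup dual_gog, pi1 v z & dual_eval z = g.
Proof.
have [_ con _] := tree_is_tree T.
have [p pP] := con (liftV v) (actV g (liftV v)).
have [z bz ez] := dual_eval_surj_path pP (esym (actV1 _)) (erefl _).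
by exists z => //; rewrite ez invg1 mul1g.
Qed.

Inductive lpath : vert dual_gog -> bassGroup dual_gog -> vert dual_gog ->
    seq (edge T) -> Prop :=
  | lpath_vert u g (gu : gV u g) : lpath u (bV gu) u [::]
  | lpath_edge e g (ge : gV (src e) g) x w p :
      lpath (tgt e) x w p ->
      lpath (src e) (bV ge * bE e * x) w
        (actE (g * (lift_elt (erev e))^-1) (liftE e) ::
         map (actE (g * ((lift_elt (erev e))^-1 * lift_elt e))) p).

Lemma bpath_lpath u x w : bpath u x w -> exists p, lpath u x w p.
Proof.
elim=> [{}u g gu|e g ge {}x {}w _ [p pP]]; first by exists [::]; constructor.
by eexists; apply: lpath_edge pP.
Qed.

Lemma lpath_bpath u x w p : lpath u x w p -> bpath u x w.
Proof. by elim=> *; constructor. Qed.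

Lemma gpath_act g (x : vert T) p y :
  gpath x p y -> gpath (actV g x) (map (actE (c := T) g) p) (actV g y).
Proof.
elim: p x => [|e p IH] x /=; first by move=> ->.
by move=> [<- /IH]; rewrite act_src act_tgt.
Qed.

Lemma lpath_gpath u x w p :
  lpath u x w p -> gpath (liftV u) p (actV (dual_eval x) (liftV w)).
Proof.
elim=> [{}u g gu|e g ge {}x {}w {}p _ IH] /=.
  by rewrite dual_evalV gu.
split.
  by rewrite act_src -lift_eltP_src actVM actVK ge.
rewrite !dual_evalM dual_evalV dual_evalE act_tgt -lift_eltP.
move: (gpath_act (g * ((lift_elt (erev e))^-1 * lift_elt e)) IH).
by rewrite -!actVM !mulgA.
Qed.

Lemma reduced_act g (p : seq (edge T)) : reduced (map (actE (c := T) g) p) <-> reduced p.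
Proof.
elim: p => [//|e [|e' p] IH] //=.
split=> -[ne /IH r]; split=> // ee'; apply: ne.
  by rewrite ee' act_rev.
by apply: (can_inj (actEK g)); rewrite ee' act_rev.
Qed.

Lemma lpath_mull u w g (gu : gV u g) x p :
  lpath u x w p -> exists2 q, lpath u (bV gu * x) w q & size q = size p.
Proof.
move=> b; case: _ _ _ _ / b gu => [u' h hu|e h he y w' q b] gu.
  exists [::] => //; rewrite -(bVM gu hu (gVM gu hu)); exact: lpath_vert.
eexists; first by rewrite !mulgA -(bVM gu he (gVM gu he)); apply: lpath_edge b.
by rewrite /= !size_map.
Qed.

Lemma lpath_cons_inv u x w f p : lpath u x w (f :: p) ->
  exists e g (gu : gV u g) y q,
    [/\ u = src e, lpath (tgt e) y w q, x = bV gu * bE e * y, size q = size p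
      & f = actE (g * (lift_elt (erev e))^-1) (liftE e)].
Proof.
move E: (f :: p) => fp b; case: _ _ _ _ / b E => // e g ge {}x {}w q b [-> ->].
by exists e, g, ge, x, q; split; rewrite ?size_map.
Qed.

Lemma lpath_shorten u x w p : lpath u x w p -> ~ reduced p ->
  exists2 q, lpath u x w q & (size q < size p)%N.
Proof.
elim=> [{}u g gu|e g ge {}x {}w {}p b IH] nr; first by case: nr.
have [rp|/IH[q bq sq]] := pselect (reduced p); last first.
  by eexists; [apply: lpath_edge bq|rewrite /= !size_map].
case: p b rp nr {IH} => [|f p] b rp nr; first by case: nr.
have [e' [g' [ge' [y [q [ue' bq xE sq fE]]]]]] := lpath_cons_inv b.
have ff : actE (g * ((lift_elt (erev e))^-1 * lift_elt e)) f =
          erev (actE (g * (lift_elt (erev e))^-1) (liftE e)).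
  apply: contrapT => ne; apply: nr; split; first exact: ne.
  exact/(reduced_act _ (f :: p)).
have qEa m E : qE Q (actE m E) = qE Q E by apply/esym/qEP; exists m.
have e'E : e' = erev e.
  have := congr1 (qE Q) ff; rewrite fE act_rev !qEa -liftE_rev.
  by rewrite !liftEK.
subst e'; move: ff; rewrite fE act_rev -liftE_rev erevK -!actEM => ff.
have kE : gE (e : edge dual_gog) (lift_elt e * g' * (lift_elt e)^-1).
  rewrite -gE_rev /= /stabE /=.
  apply: (can_inj (actEK (g * (lift_elt (erev e))^-1))).
  by rewrite -actEM -ff !mulgA.
have g'E : g' = att (e : edge dual_gog) (lift_elt e * g' * (lift_elt e)^-1).
  by rewrite /= conjgE mulgVK mulKg.
have -> : bV ge * bE e * x = bV ge * bV (att_src kE) * y.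
  rewrite xE (bV_eq _ (att_fun kE) g'E) bE_erev !mulgA -[_ * bE e * _]mulgA.
  by rewrite -bE_att mulgA mulgK.
rewrite -(bVM ge (att_src kE) (gVM ge (att_src kE))).
have [q' bq' sq'] := lpath_mull (gVM ge (att_src kE)) bq.
by exists q' => //; rewrite sq' /= size_map -sq.
Qed.

Lemma dual_eval_pi1_eq1 v (x : bassGroup dual_gog) :
  pi1 v x -> dual_eval x = 1 -> x = 1.
Proof.
move=> /bpath_lpath[p]; have [n] := ubnP (size p).
elim: n p x => // n IH p x; rewrite ltnS => sp b x1.
have [rp|nr] := pselect (reduced p); last first.
  have [q bq sq] := lpath_shorten b nr.
  by apply: IH bq x1; apply: leq_trans sq sp.
have := lpath_gpath b; rewrite x1 actV1 => cp.
have [_ _ /(_ _ _ cp rp) p0] := tree_is_tree T.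
move: b x1; rewrite p0; move E: [::] => p' b.
case: _ _ _ _ / b E => // u g gu _; rewrite dual_evalV => g1.
by rewrite (bV_eq _ (gV1 u) g1) bV1.
Qed.

End DualGraphOfGroups.

Section Out.
Variable gT : groupType.

Record automorphism := Automorphism {
  aut_mor :> {multiplicative gT -> gT};
  aut_bij : bijective aut_mor
}.

HB.instance Definition _ := gen_eqMixin automorphism.
HB.instance Definition _ := gen_choiceMixin automorphism.

Definition inner_equiv (a b : automorphism) := exists g, forall x, b x = a x ^ g.

Definition inner_equivb : rel automorphism := fun a b => `[< inner_equiv a b >].

Lemma inner_equivb_equiv : equiv_class_of inner_equivb.
Proof.
split=> [a|a b|b a c]; first by apply/asboolP; exists 1 => x; rewrite conjg1.
  by apply/asboolP/asboolP => -[g ab]; exists g^-1 => x; rewrite ab ?conjgK.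
move=> /asboolP[g ab] /asboolP[h bc]; apply/asboolP; exists (g * h) => x.
by rewrite bc ab conjgM.
Qed.

Canonical inner_equiv_rel := EquivRelPack inner_equivb_equiv.

Definition Out := {eq_quot inner_equiv_rel}%qT.

Definition out_class (a : automorphism) : Out := (\pi_(Out) a)%qT.

Lemma out_classP a b : out_class a = out_class b <-> inner_equiv a b.
Proof.
split; first by move/eqmodP => /asboolP.
by move=> c; apply/eqmodP/asboolP.
Qed.

End Out.

Section NaturalMap.
Variables (gT : groupType) (T : coloured_tree gT) (Q : quotient_data T).
Variables (D : deltaAut (dual_gog Q)) (v : vert (dual_gog Q)).
Local Notation ev := (@dual_eval _ _ Q).

Lemma ev1 : ev 1 = 1.
Proof. by apply: (mulgI (ev 1)); rewrite -dual_evalM !mulg1. Qed.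

Lemma evV x : ev x^-1 = (ev x)^-1.
Proof. by apply/esym/mulg1_eq; rewrite -dual_evalM mulgV ev1. Qed.

Lemma bpath_inv (u w : vert (dual_gog Q)) x : bpath u x w -> bpath w x^-1 u.
Proof.
elim=> [{}u g gu|e g ge {}x {}w _ IH].
  by rewrite -(bVV gu (gVV gu)); apply: bpath_vert.
rewrite !invgM; apply: bpath_mul IH _.
have g1 := gV1 (tgt e).
have -> : (bE e)^-1 * (bV ge)^-1 = bV g1 * bE (erev e) * bV (gVV ge).
  by rewrite bV1 mul1g bE_erev (bVV ge).
apply: (@bpath_edge_eq _ _ (tgt e) (erev e)); first by rewrite /src erevK.
exact: bpath_vert.
Qed.

Lemma dual_eval_pi1_inj (u : vert (dual_gog Q)) :
  {in pi1 u &, injective ev}.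
Proof.
move=> x y; rewrite !inE => xu yu xy; apply: divg1_eq.
apply: (@dual_eval_pi1_eq1 _ _ Q u); first exact/(bpath_mul xu)/bpath_inv.
by rewrite dual_evalM evV xy mulgV.
Qed.

(* The inverse of the isomorphism from pi1 v to gT induced by dual_eval. *)
Definition dual_inv (g : gT) : bassGroup (dual_gog Q) :=
  s2val (cid2 (dual_eval_surj v g)).

Lemma dual_inv_pi1 g : pi1 v (dual_inv g).
Proof. exact: s2valP (cid2 (dual_eval_surj v g)). Qed.

Lemma dual_invK : cancel dual_inv ev.
Proof. by move=> g; apply: s2valP' (cid2 (dual_eval_surj v g)). Qed.

Lemma dual_evalK x : pi1 v x -> dual_inv (ev x) = x.
Proof.
move=> xv; apply: (@dual_eval_pi1_inj v); rewrite ?inE ?dual_invK//.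
exact: dual_inv_pi1.
Qed.

(* The isomorphism pi1 v -> pi1 (autV D v) induced by D, read in gT through
   dual_eval at both ends. Identifying pi1 (autV D v) with pi1 v by conjugation
   by a path changes it by an inner automorphism only. *)
Definition natural_fun (g : gT) : gT := ev (delta_bass D (dual_inv g)).

Lemma natural_funE x : pi1 v x -> natural_fun (ev x) = ev (delta_bass D x).
Proof. by move=> xv; rewrite /natural_fun dual_evalK. Qed.

Lemma natural_funM : {morph natural_fun : g h / g * h}.
Proof.
move=> g h; rewrite -{1}(dual_invK g) -{1}(dual_invK h) -dual_evalM.
rewrite natural_funE ?delta_bassM ?dual_evalM//.
exact/(bpath_mul (dual_inv_pi1 g))/dual_inv_pi1.
Qed.

HB.instance Definition _ := isMultiplicative.Build _ _ natural_fun natural_funM.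

Lemma natural_fun_bij : bijective natural_fun.
Proof.
rewrite -setTT_bijective; split=> // [g h _ _ gh|g _].
  rewrite -(dual_invK g) -(dual_invK h); congr (ev _).
  apply: (@delta_bass_inj _ _ D); move: gh.
  by apply: dual_eval_pi1_inj; rewrite inE; apply/delta_bpath/dual_inv_pi1.
have [y yv yg] := dual_eval_surj (autV D v) g.
have [x xv xy] := delta_bpath_surj yv (erefl _) (erefl _).
by exists (ev x) => //; rewrite natural_funE// xy.
Qed.

Definition natural_aut : automorphism gT := Automorphism natural_fun_bij.

Definition natural_map : Out gT := out_class natural_aut.

End NaturalMap.

Lemma natural_map_basepoint (gT : groupType) (T : coloured_tree gT)
    (Q : quotient_data T) (D : deltaAut (dual_gog Q)) (v w : vert (dual_gog Q)) :
  natural_map D v = natural_map D w.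
Proof.
have [_ con _] := tree_is_tree T.
have [p pP] := con (liftV v) (liftV w).
have [z bz ez] :=
  dual_eval_surj_path pP (esym (actV1 _)) (esym (actV1 (liftV w))).
apply/out_classP; exists (dual_eval (delta_bass D z)) => g.
have ez1 : dual_eval z = 1 by rewrite ez invg1 mul1g.
rewrite /= [LHS]/natural_fun.
set x := dual_inv w g; have xw : pi1 w x by apply: dual_inv_pi1.
have zxz : pi1 v (z * x * z^-1).
  by apply: bpath_mul (bpath_mul bz xw) _; apply: bpath_inv.
have gE : g = dual_eval (z * x * z^-1).
  by rewrite !dual_evalM evV dual_invK ez1 invg1 mul1g mulg1.
rewrite gE natural_funE// conjgE -evV -!dual_evalM; congr dual_eval.
apply: (mulgI (delta_bass D z)); rewrite !mulgA mulgV mul1g.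
by rewrite -!delta_bassM mulgVK.
Qed.

Lemma quotient_data_exists (gT : groupType) (T : coloured_tree gT) :
  inhabited (quotient_data T).
Proof.
pose oV (x : vert T) : set (vert T) := [set actV g x | g in setT].
pose oE (e : edge T) : set (edge T) := [set actE g e | g in setT].
have oVP x y : oV x = oV y <-> exists g, y = actV g x.
  split=> [xy|[g ->]].
    have : oV y y by exists 1; rewrite ?actV1.
    by rewrite -xy => -[g _ <-]; exists g.
  apply/seteqP; split=> _ [h _ <-].
    by exists (h * g^-1) => //; rewrite actVM actVK.
  by exists (h * g) => //; rewrite actVM.
have oEP x y : oE x = oE y <-> exists g, y = actE g x.
  split=> [xy|[g ->]].
    have : oE y y by exists 1; rewrite ?actE1.
    by rewrite -xy => -[g _ <-]; exists g.
  apply/seteqP; split=> _ [h _ <-].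
    by exists (h * g^-1) => //; rewrite actEM actEK.
  by exists (h * g) => //; rewrite actEM.
pose VX := {A : set (vert T) | exists x, A = oV x}.
pose EX := {A : set (edge T) | exists e, A = oE e}.
pose qv x : VX := exist _ (oV x) (ex_intro _ x erefl).
pose qe e : EX := exist _ (oE e) (ex_intro _ e erefl).
have sig_eq (U : Type) (P : U -> Prop) (a b : {x | P x}) :
    sval a = sval b -> a = b.
  case: a b => a pa [b pb] /= ab; subst b; congr exist.
  exact: Prop_irrelevance.
have qvP x y : qv x = qv y <-> exists g, y = actV g x.
  rewrite -oVP; split=> [/(congr1 sval)//|xy]; exact: sig_eq.
have qeP x y : qe x = qe y <-> exists g, y = actE g x.
  rewrite -oEP; split=> [/(congr1 sval)//|xy]; exact: sig_eq.
pose sv (a : VX) : vert T := sval (cid (svalP a)).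
pose se0 (a : EX) : edge T := sval (cid (svalP a)).
have svK : cancel sv qv.
  by move=> a; apply: sig_eq; rewrite /= /sv; case: (cid _) => x /= ->.
have se0K : cancel se0 qe.
  by move=> a; apply: sig_eq; rewrite /= /se0; case: (cid _) => x /= ->.
pose rX (a : EX) : EX := qe (erev (se0 a)).
pose tX (a : EX) : VX := qv (tgt (se0 a)).
have tXE e : qv (tgt e) = tX (qe e).
  rewrite /tX; have /qeP[g ->] := esym (se0K (qe e)).
  by apply/qvP; exists g; rewrite act_tgt.
have rXE e : qe (erev e) = rX (qe e).
  rewrite /rX; have /qeP[g ->] := esym (se0K (qe e)).
  by apply/qeP; exists g; rewrite act_rev.
have rXK : involutive rX by move=> a; rewrite {2}/rX -rXE erevK se0K.
have rX_neq a : rX a <> a.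
  rewrite -{2}(se0K a) => /esym/qeP[g /esym]; exact: act_noinv.
pose pair a : set {classic EX} := [set b | b = a \/ b = rX a].
have pair_rX a : pair (rX a) = pair a.
  by apply/seteqP; split=> b [] ->; [right|left|right|left]; rewrite ?rXK.
pose c (a : EX) : EX := xget (a : {classic EX}) (pair a).
have cP a : c a = a \/ c a = rX a.
  by have : pair a (c a) by apply: xgetPex; exists a; left.
have c_rX a : c (rX a) = c a.
  rewrite /c pair_rX /xget; case: pselect => // -[].
  by exists a; apply/asboolP; left.
pose se (a : EX) : edge T :=
  if pselect (c a = a) then se0 a else erev (se0 (rX a)).
have seK : cancel se qe.
  move=> a; rewrite /se; case: pselect => [ca|ca]; first exact: se0K.
  by rewrite rXE se0K rXK.
have se_rev a : se (rX a) = erev (se a).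
  rewrite /se c_rX rXK; case: pselect => h1; case: pselect => h2 //.
  - by case: (rX_neq a); rewrite -h1.
  - by rewrite erevK.
  - by case: (cP a).
pose X := Graph tX rXK rX_neq.
have hP (a : EX) : {g | actV g (sv (tX a)) = tgt (se a)}.
  apply: cid; have /qvP[g ->] : qv (sv (tX a)) = qv (tgt (se a)).
    by rewrite svK tXE seK.
  by exists g.
constructor.
exact: (@QuotientData _ T X qv qe tXE rXE qvP qeP sv se svK seK se_rev
  (fun a => sval (hP a)) (fun a => svalP (hP a))).
Qed.

(* Main.v *)
Require Import Defs.
From HB Require Import structures.
From mathcomp Require Import all_boot all_algebra.
From mathcomp Require Import boolp classical_sets functions.
From mathcomp Require Import zify ring.

(* An automorphism a of the group is realized by an a-equivariant automorphism
   of the tree T, and hence by an automorphism of the quotient graph of groups.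
   To find the former, suppose that T has an edge, and let v be a white vertex.
   The element t_v lies in the stabilizer Z^2 of a black neighbour, and subgroups Z^2 act on T by elliptic
   elements, so that a(t_v) fixes a vertex. A nontrivial elliptic element has a
   centralizer that fixes a vertex, hence a(Gamma_v), which centralizes a(t_v),
   fixes one; being nonabelian it fixes exactly one white vertex a(v), and, by
   the same argument for the inverse of a, it is the whole stabilizer of a(v).
   Two white vertices are at distance at most 2 if and only if the centre of the
   stabilizer of one is contained in the stabilizer of the other, so a preserves
   this relation; and black vertices correspond to the maximal sets of at least
   two white vertices that are pairwise at distance at most 2. *)

Set Implicit Arguments.
Unset Strict Implicit.
Unset Printing Implicit Defensive.

Local Open Scope classical_set_scope.

Lemma ex_argmin (I : Type) (P : I -> Prop) (f : I -> nat) (i : I) :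
  P i -> exists2 j, P j & forall k, P k -> (f j <= f k)%N.
Proof.
have [n] := ubnP (f i); elim: n i => // n IH i fin Pi.
have [[k Pk fk]|nex] := pselect (exists2 k, P k & (f k < f i)%N).
  by apply: (IH k) => //; lia.
exists i => // k Pk; rewrite leqNgt; apply/negP => fk; apply: nex.
by exists k.
Qed.

(** * The metric of a tree *)

Section TreeMetric.
Variable X : graph.
Implicit Types (x y z w : vert X) (e f : edge X) (p q : seq (edge X)).

(** Length of the longest common prefix; for two geodesics issuing from one vertex this is the
    Gromov product of their endpoints. *)
Fixpoint lcp p q : nat :=
  match p, q with
  | e :: p', f :: q' => if pselect (e = f) then (lcp p' q').+1 else 0
  | _, _ => 0
  end.

Lemma lcpC p q : lcp p q = lcp q p.
Proof.
elim: p q => [|e p IH] [|f q] //=; rewrite IH.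
by case: pselect => h1; case: pselect => h2 //; congruence.
Qed.

Lemma lcp_ultrametric p q r : (minn (lcp p q) (lcp p r) <= lcp q r)%N.
Proof.
elim: p q r => [|e p IH] [|f q] [|g r] //=.
  by case: pselect; rewrite ?minn0.
case: pselect => [ef|_] /=; last by rewrite min0n.
case: pselect => [eg|_] /=; last by rewrite minn0.
by case: pselect => [_|] /=; [rewrite minnSS ltnS|congruence].
Qed.

Lemma lcp_leq p q : (lcp p q <= size p)%N.
Proof.
by elim: p q => [|e p IH] [|f q] //=; case: pselect => //= _; apply: IH.
Qed.

Lemma lcp_eq p q : (size p <= lcp p q)%N -> (size q <= lcp p q)%N -> p = q.
Proof.
elim: p q => [|e p IH] [|f q] //=; case: pselect => //= <- hp hq.
by rewrite (IH q).
Qed.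

Lemma reduced_cons e p :
  reduced (e :: p) <-> (forall p', p <> erev e :: p') /\ reduced p.
Proof.
case: p => [|f p] /=; first by split=> // -[].
split=> -[h r]; split=> //; first by move=> p' [/h].
by move=> fe; apply: (h p); rewrite fe.
Qed.

Lemma gpath_catrev x y z p q : gpath x p y -> gpath x q z ->
  gpath y (catrev (map (@erev X) p) q) z.
Proof.
elim: p x q => [|e p IH] x q /=; first by move=> ->.
by move=> [<- py] qz; apply: IH py _ => /=; split=> //; rewrite /src erevK.
Qed.

Lemma reduced_catrev p q : reduced p -> reduced q -> lcp p q = 0 ->
  reduced (catrev (map (@erev X) p) q).
Proof.
elim: p q => [//|e p IH] q rep rq lpq; have [ne rp] := (reduced_cons _ _).1 rep.
rewrite /=; apply: IH => //.
  apply/reduced_cons; split=> // q'; rewrite erevK => qE.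
  by move: lpq; rewrite qE /=; case: pselect.
case: p ne {lpq rep rp} => //= f p ne.
by case: pselect => // fe; case: (ne p); rewrite fe.
Qed.

(** Once the common prefix is dropped, reversing the rest of [p] and continuing along the rest of
    [q] causes no backtracking; each prefix edge is lost twice in the length. *)
Lemma reduced_diff x y z p q : gpath x p y -> gpath x q z ->
  reduced p -> reduced q ->
  exists r, [/\ gpath y r z, reduced r
    & (size r + (lcp p q).*2 = size p + size q)%N].
Proof.
elim: p x q => [|e p IH] x [|f q] px qx rp rq.
- by exists [::]; move: px => /= <-; split.
- by exists (f :: q); move: px => /= <-; split=> //=; lia.
- exists (catrev (map (@erev X) (e :: p)) [::]); split.
  + exact: gpath_catrev px qx.
  + exact: reduced_catrev.
  + by rewrite catrevE size_cat size_rev size_map /=; lia.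
move: (@reduced_catrev _ _ rp rq) => /=.
case: pselect => [ef _|_ /(_ erefl) r] /=.
  subst f; have [_ pt] := px; have [_ qt] := qx.
  have [r [ry rr sr]] := IH _ _ pt qt ((reduced_cons _ _).1 rp).2
                            ((reduced_cons _ _).1 rq).2.
  by exists r; split=> //; lia.
exists (catrev (map (@erev X) (e :: p)) (f :: q)); split=> //.
  exact: gpath_catrev px qx.
by rewrite catrevE size_cat size_rev size_map addn0.
Qed.

Lemma reduced_exists x y p : gpath x p y ->
  exists2 q, gpath x q y & reduced q /\ (size q <= size p)%N.
Proof.
elim: p x => [|e p IH] x /=; first by exists [::].
move=> [ex /IH[q qy [rq sq]]].
have [[q' qE]|ne] := pselect (exists q', q = erev e :: q').
  subst q; exists q'; first by move: qy; rewrite /= /src erevK -ex => -[].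
  by split; [case/reduced_cons: rq|move: sq => /=; lia].
exists (e :: q) => //; split=> //; apply/reduced_cons; split=> // q' qE.
by apply: ne; exists q'.
Qed.

Hypothesis treeX : is_tree X.

(** The path from [reduced_diff] is closed, hence empty, and the length count forces the common
    prefix to exhaust both paths. *)
Lemma reduced_uniq x y p q :
  gpath x p y -> gpath x q y -> reduced p -> reduced q -> p = q.
Proof.
move=> px qx rp rq; have [r [ry rr]] := reduced_diff px qx rp rq.
have [_ _ acyc] := treeX; rewrite (acyc _ _ ry rr) /= => sr.
by have := (lcp_leq p q, lcp_leq q p); rewrite (lcpC q p) => -[] *;
  apply: lcp_eq; lia.
Qed.

Lemma geodesic_exists x y : exists p, gpath x p y /\ reduced p.
Proof.
have [_ con _] := treeX; have [p pxy] := con x y.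
by have [q qxy [rq _]] := reduced_exists pxy; exists q.
Qed.

Definition geodesic x y : seq (edge X) := sval (cid (geodesic_exists x y)).
Definition dist x y : nat := size (geodesic x y).

Lemma geodesic_gpath x y : gpath x (geodesic x y) y.
Proof. by rewrite /geodesic; case: cid => p []. Qed.

Lemma geodesic_reduced x y : reduced (geodesic x y).
Proof. by rewrite /geodesic; case: cid => p []. Qed.

Lemma dist_reduced x y p : gpath x p y -> reduced p -> dist x y = size p.
Proof.
move=> pxy rp; congr size.
by apply: reduced_uniq (geodesic_gpath x y) pxy (geodesic_reduced x y) rp.
Qed.

Lemma dist_gball x y n : gball x n y <-> (dist x y <= n)%N.
Proof.
split=> [[p /reduced_exists[q qxy [rq sq]] pn]|dn].
  by rewrite (dist_reduced qxy rq); apply: leq_trans pn.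
by exists (geodesic x y) => //; apply: geodesic_gpath.
Qed.

Lemma distxx x : dist x x = 0.
Proof. exact: (@dist_reduced x x [::]). Qed.

Lemma dist_eq0 x y : dist x y = 0 -> x = y.
Proof. by have := geodesic_gpath x y; rewrite /dist; case: (geodesic x y). Qed.

Lemma dist_diff x y z :
  (dist y z + (lcp (geodesic x y) (geodesic x z)).*2 = dist x y + dist x z)%N.
Proof.
have [r [rz rr sr]] := reduced_diff (geodesic_gpath x y) (geodesic_gpath x z)
  (geodesic_reduced x y) (geodesic_reduced x z).
by rewrite (dist_reduced rz rr).
Qed.

Lemma distC x y : dist x y = dist y x.
Proof.
have := dist_diff x y x; rewrite distxx addn0 => <-.
by rewrite lcpC (size0nil (distxx x)) /= addn0.
Qed.

(** Trees are 0-hyperbolic: [dist_diff] turns the ultrametric inequality for common prefixes of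
    geodesics from [w] into one on distances. *)
Lemma four_point x y z w : (dist x y + dist z w <=
  maxn (dist x z + dist y w) (dist x w + dist y z))%N.
Proof.
have := dist_diff w x y; have := dist_diff w x z; have := dist_diff w y z.
have := lcp_ultrametric (geodesic w z) (geodesic w x) (geodesic w y).
rewrite (lcpC (geodesic w z)) (lcpC (geodesic w z)).
rewrite (distC z w) (distC x w) (distC y w); lia.
Qed.

Lemma dist_triangle y x z : (dist x z <= dist x y + dist y z)%N.
Proof. by have := four_point x z y y; rewrite distxx (distC z y); lia. Qed.

Lemma dist_edge e : dist (src e) (tgt e) = 1.
Proof. exact: (@dist_reduced _ _ [:: e]). Qed.

Lemma dist1_edge x y : dist x y = 1 -> exists2 e, src e = x & tgt e = y.
Proof.
have := geodesic_gpath x y; rewrite /dist.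
by case: (geodesic x y) => [|e [|f p]] //= [ex ey] _; exists e.
Qed.

Lemma edge_ext e f : src e = src f -> tgt e = tgt f -> e = f.
Proof.
move=> se te; have [//] : [:: e] = [:: f].
by apply: (@reduced_uniq (src e) (tgt e)).
Qed.

Lemma dist_step x y n : dist x y = n.+1 ->
  exists2 z, dist x z = 1 & dist z y = n.
Proof.
have := geodesic_gpath x y; have := geodesic_reduced x y; rewrite /dist.
case: (geodesic x y) => [|e p] //= [_ rp] [<- py] [<-].
by exists (tgt e); [apply: dist_edge|apply: dist_reduced].
Qed.

(** The four-point inequality bounds [dist x y + dist z z'] by [dist x y]. *)
Lemma between_uniq x y z z' : dist x z = dist x z' -> dist z y = dist z' y ->
  (dist x y = dist x z + dist z y)%N -> z = z'.
Proof.
move=> xz zy xy; apply: dist_eq0; have := four_point x y z z'.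
by rewrite (distC y z) (distC y z'); lia.
Qed.

Hypothesis leafless : no_valence_one X.

(** A second edge at [y] prolongs the geodesic from [x] without backtracking. *)
Lemma dist_extend x y : x <> y ->
  exists2 z, dist y z = 1 & dist x z = (dist x y).+1.
Proof.
move=> xy; have := geodesic_gpath y x; have := geodesic_reduced y x.
rewrite distC /dist; case: (geodesic y x) => [_ yx|e p rp /= [ey px]].
  by case: xy; rewrite yx.
have [e' ne te'] := leafless (erev e).
exists (src e'); first by rewrite -/(dist _ _) distC -ey -[src e]te' dist_edge.
rewrite -/(dist _ _) distC; apply: (@dist_reduced _ _ (e' :: e :: p)) => /=.
  by rewrite te'.
by split=> // eE; apply: ne; rewrite eE erevK.
Qed.

End TreeMetric.

Local Open Scope group_scope.

(** * Integer powers and free abelian groups of rank two *)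

Section IntegerPowers.
Variable gT : groupType.
Implicit Types (x y : gT) (m n : int) (H : set gT).

Lemma zexpgSr x n : zexpg x (n + 1)%R = zexpg x n * x.
Proof.
case: n => [n|[|n]].
- by rewrite /= -expgSr addn1.
- by rewrite /= mulVg.
- have -> : (Negz n.+1 + 1 = Negz n)%R by lia.
  by rewrite /= [x ^+ n.+2]expgSS invgM mulgVK.
Qed.

Lemma zexpgD x m n : zexpg x (m + n)%R = zexpg x m * zexpg x n.
Proof.
elim/int_rect: n => [|n IH|n IH]; first by rewrite GRing.addr0 mulg1.
  by rewrite -addn1 PoszD GRing.addrA !zexpgSr IH mulgA.
apply: (mulIg x); rewrite -mulgA -!zexpgSr.
have -> : (m - n.+1%:Z + 1 = m - n%:Z)%R by lia.
by have -> : (- n.+1%:Z + 1 = - n%:Z)%R by lia.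
Qed.

Lemma zexpg_hom (h : int -> gT) n :
  (forall k l, h (k + l)%R = h k * h l) -> h n = zexpg (h 1%R) n.
Proof.
move=> hD; have h0 : h 0%R = 1.
  by apply: (mulgI (h 0%R)); rewrite -hD mulg1.
elim/int_rect: n => [//|n IH|n IH].
  by rewrite -addn1 PoszD zexpgSr hD IH.
apply: (mulIg (h 1%R)); rewrite -zexpgSr -hD.
by have -> : (- n.+1%:Z + 1 = - n%:Z)%R by lia.
Qed.

Lemma zexpgM x m n : zexpg x (m * n)%R = zexpg (zexpg x m) n.
Proof.
rewrite (@zexpg_hom (fun k => zexpg x (m * k)%R)) ?GRing.mulr1// => k l.
by rewrite GRing.mulrDr zexpgD.
Qed.

Lemma commute_zexpg x y n : commute x y -> commute x (zexpg y n).
Proof. by case: n => n xy /=; [|apply: commuteV]; apply: commuteX. Qed.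

Lemma subgroupM H x y : subgroup H -> H x -> H y -> H (x * y).
Proof.
by move=> [H1 HF] Hx Hy; rewrite -[y]invgK -(div1g y); do !apply: (HF).
Qed.

Lemma subgroupV H x : subgroup H -> H x -> H x^-1.
Proof. by move=> [H1 HF] Hx; rewrite -div1g; apply: (HF). Qed.

Lemma subgroup_zexpg H x n : subgroup H -> H x -> H (zexpg x n).
Proof.
move=> sH Hx; have HX k : H (x ^+ k).
  elim: k => [|k IH]; first by case: sH.
  by rewrite expgSr; apply: subgroupM.
by case: n => n /=; [|apply: subgroupV].
Qed.

Section Rank2.
Variable B : set gT.
Hypothesis B2 : free_abelian_rank2 B.

Lemma rank2_abelian : set_abelian B.
Proof.
have [f [fD _ <-]] := B2 => _ _ [u _ <-] [v _ <-].
by rewrite -!fD GRing.addrC.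
Qed.

Lemma rank2_subgroup : subgroup B.
Proof.
have [f [fD _ <-]] := B2.
have f0 : f 0%R = 1 by apply: (mulgI (f 0%R)); rewrite -fD mulg1.
split=> [|_ _ [u _ <-] [v _ <-]]; first by exists 0%R.
exists (u - v)%R => //; apply: (mulIg (f v)).
by rewrite -fD mulgVK GRing.subrK.
Qed.

Lemma rank2_param : exists f : int * int -> gT,
  [/\ forall u v, f (u + v)%R = f u * f v, injective f, range f = B, f 0%R = 1
    & forall a b n, zexpg (f (a, b)) n = f (a * n, b * n)%R].
Proof.
have [f [fD fI fB]] := B2; exists f; split=> //.
  by apply: (mulgI (f 0%R)); rewrite -fD mulg1.
move=> a b n; rewrite [RHS](@zexpg_hom (fun k => f (a * k, b * k)%R)).
  by rewrite !GRing.mulr1.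
by move=> k l; rewrite -fD !GRing.mulrDr.
Qed.

(* Cramer's rule for three vectors of a rank two lattice. *)
Lemma rank2_relation x y z : B x -> B y -> B z -> x <> 1 ->
  (exists i j l : int, l <> 0%R /\ zexpg x i * zexpg y j * zexpg z l = 1) \/
  (exists i j : int, j <> 0%R /\ zexpg x i = zexpg y j).
Proof.
have [f [fD fI <- f0 fX]] := rank2_param.
move=> [[x1 x2] _ <-] [[y1 y2] _ <-] [[z1 z2] _ <-] x_neq1.
have [xy|xy] := eqVneq (x1 * y2 - x2 * y1)%R 0%R; last first.
  left; exists (y1 * z2 - y2 * z1)%R, (z1 * x2 - z2 * x1)%R.
  exists (x1 * y2 - x2 * y1)%R.
  split; first exact/eqP.
  rewrite !fX -!fD -f0; congr f; rewrite /=.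
  by apply: injective_projections => /=; ring.
(* Now [x] and [y] are proportional; the exponent of [y] is taken to be a nonzero coordinate of
   [x]. *)
right; have [x10|x10] := eqVneq x1 0%R.
  have x20 : x2 <> 0%R by move=> x20; apply: x_neq1; rewrite x10 x20 f0.
  exists y2, x2; split=> //; rewrite !fX /=; congr (f (_, _)); lia.
exists y1, x1; split; first exact/eqP.
rewrite !fX /=; congr (f (_, _)); lia.
Qed.

(** If the basis vectors were [x ^ m] and [x ^ n], then [f (n, 0)] and [f (0, m)] would both be
    [x ^ (m * n)], so [n = 0] and the second vector would be trivial. *)
Lemma rank2_not_cyclic x : ~ B `<=` zcycle x.
Proof.
have [f [fD fI fB f0 fX]] := rank2_param; rewrite -fB => Bx.
have [m _ xm] : zcycle x (f (1, 0)%R) by apply: Bx; exists (1, 0)%R.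
have [n _ xn] : zcycle x (f (0, 1)%R) by apply: Bx; exists (0, 1)%R.
have : f (n, 0)%R = f (0, m)%R.
  have <- : zexpg (f (1, 0)%R) n = f (n, 0)%R.
    by rewrite fX GRing.mul1r GRing.mul0r.
  have <- : zexpg (f (0, 1)%R) m = f (0, m)%R.
    by rewrite fX GRing.mul1r GRing.mul0r.
  by rewrite -xm -xn -!zexpgM GRing.mulrC.
move=> /fI[n0 _]; move: xn; rewrite n0 /= expg0 -f0 => /fI.
by case.
Qed.

End Rank2.
End IntegerPowers.

(** * Centralizers and elliptic elements *)

Section Suspension.
Variables (gT : groupType) (T : coloured_tree gT).
Implicit Types (x y z u v w b c : vert T) (g h k s t : gT).
Local Notation d := (dist (tree_is_tree T)).

Lemma dist_act g x y : d (actV g x) (actV g y) = d x y.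
Proof.
have rp := geodesic_reduced (tree_is_tree T) x y.
rewrite (dist_reduced _ (gpath_act g (geodesic_gpath (tree_is_tree T) x y))).
  by rewrite size_map.
exact/reduced_act.
Qed.

Lemma white_dist x y : white y = white x (+) odd (d x y).
Proof.
move Ed : (d x y) => n; elim: n x Ed => [|n IH] x.
  by move=> /dist_eq0 ->; rewrite addbF.
move=> /dist_step[z xz /IH ->]; have [e <- <-] := dist1_edge xz.
by rewrite white_adj /=; case: (white _) (odd n) => [] [].
Qed.

Lemma fix_between g x y z : stabV x g -> stabV y g ->
  (d x y = d x z + d z y)%N -> stabV z g.
Proof.
move=> gx gy xzy; apply/esym/(between_uniq _ _ xzy).
  by rewrite -[LHS](dist_act g) (gx : actV g x = x).
by rewrite -[LHS](dist_act g) (gy : actV g y = y).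
Qed.

Lemma stabV_commute g h x : commute g h -> stabV x g -> stabV (actV h x) g.
Proof. by move=> gh gx; rewrite /stabV /= -actVM gh actVM gx. Qed.

Lemma stabVM x g h : stabV x g -> stabV x h -> stabV x (g * h).
Proof. exact: (subgroupM (stabV_subgroup x)). Qed.

Lemma stabV_zexpg x g n : stabV x g -> stabV x (zexpg g n).
Proof. exact: (subgroup_zexpg _ (stabV_subgroup x)). Qed.

Hypothesis pts : piecewise_trivial_suspension T.
Hypothesis leafless : no_valence_one T.

Lemma black_rank2 b : ~~ white b -> free_abelian_rank2 (stabV b).
Proof. by case: pts => _ + _ _; apply. Qed.

(** What is retained of [t_v], without the complement [G_v]: it generates the centre of the
    stabilizer, and the fixed sets of its nontrivial powers are known. *)
Definition white_generator v t :=
  [/\ infinite_cyclic t, stabV v t, forall g, stabV v g -> commute g t,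
      forall g, stabV v g -> (forall h, stabV v h -> commute g h) -> zcycle t g
    & forall n x, n <> 0%R -> stabV x (zexpg t n) <-> (d v x <= 2)%N].

Lemma white_generator_exists v : white v -> exists t, white_generator v t.
Proof.
have [_ _ _ /[apply]] := pts => -[G [t [sG cG it [_ Gt prod] fixt]]].
exists t; have zt : zcycle t t by exists 1%R.
have zt1 : zcycle t 1 by exists 0%R.
split=> //.
- by rewrite -prod; exists 1; [case: sG|exists t; rewrite ?mul1g].
- rewrite -prod => _ [g Gg [_ [n _ <-] <-]]; apply: commute_sym.
  by apply: commuteM; [apply/esym/Gt|apply: commute_zexpg].
(* The [G]-component of a central element is central in [G], hence trivial. *)
- rewrite -{1}prod => _ [g Gg [s ts <-]] cz; suff -> : g = 1 by rewrite mul1g.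
  apply: cG => // h Gh.
  have hgs : commute h (g * s).
    apply/commute_sym/cz; rewrite -prod.
    by exists h => //; exists 1; rewrite ?mulg1.
  have hs : commute h s by apply: Gt.
  rewrite -[g](mulgK s); apply/commute_sym/commuteM => //.
  exact: commuteV.
- move=> n x n0; rewrite -(dist_gball (tree_is_tree T)).
  by have /seteqP[h1 h2] := fixt n n0; split=> [/h1|/h2].
Qed.

Lemma generator_fix v t x : white_generator v t -> (d v x <= 2)%N -> stabV x t.
Proof. by move=> [_ _ _ _ tn] /(tn 1%R); apply. Qed.

Lemma generator_neq1 v t : white_generator v t -> t <> 1.
Proof. by move=> [it _ _ _ _] t1; have := it 1%R 0%R => /(_ t1). Qed.

(** Excludes the one-vertex tree, which [tree_twisted_automorphism] treats apart. *)
Hypothesis has_nbr : forall x, exists y, d x y = 1%N.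

Lemma two_nbrs x :
  exists y z, [/\ d x y = 1, d x z = 1 & d y z = 2]%N.
Proof.
have [y xy] := has_nbr x.
have [|z xz yz] := dist_extend (tree_is_tree T) leafless (_ : y <> x).
  by move=> yx; move: xy; rewrite yx distxx.
by exists y, z; split=> //; rewrite yz distC xy.
Qed.

(** Otherwise, going from [v] to [w] and two steps further leaves the ball around [v] but not the
    ball around [w]. *)
Lemma ball2_inj v w : (forall x, (d v x <= 2)%N <-> (d w x <= 2)%N) -> v = w.
Proof.
move=> vw; apply: contrapT => nvw.
have [y wy vy] := dist_extend (tree_is_tree T) leafless nvw.
have [|z yz vz] := dist_extend (tree_is_tree T) leafless (_ : v <> y).
  by move=> vyE; move: vy; rewrite -{1}vyE distxx.
have := dist_triangle (tree_is_tree T) y w z.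
have v0 : d v w <> 0%N by move/dist_eq0.
by move=> ?; have := (vw z).2; lia.
Qed.

(** Such an [h] preserves the fixed set of [zexpg t n], a ball of radius 2, hence its centre [v]. *)
Lemma centralizer_generator_power v t n h : white_generator v t -> n <> 0%R ->
  commute h (zexpg t n) -> stabV v h.
Proof.
move=> [_ _ _ _ tn] n0 ht; apply/esym/ball2_inj => x.
have hV : commute (zexpg t n) h^-1 by apply/commuteV/commute_sym.
have -> : d (actV h v) x = d v (actV h^-1 x).
  by rewrite -{1}(actVKV h x) dist_act.
rewrite -!(tn n)//; split=> tx; first exact: stabV_commute.
by rewrite -(actVKV h x); apply: stabV_commute => //; apply: commute_sym.
Qed.

(* If [u] is a neighbour of [b] beyond [w], then [k] and the generators at [w]
   and at [u] satisfy a nontrivial relation in the stabilizer of [b]. Since [k]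
   and the generator at [w] fix [c], which is too far from [u], the generator at
   [u] does not occur in it. *)
Lemma centralizer_fix_white b w c k h : ~~ white b ->
  d b w = 1%N -> d w c = 1%N -> d b c = 2%N ->
  k <> 1 -> stabV b k -> stabV c k -> commute h k -> stabV w h.
Proof.
move=> bb bw wc bc k1 kb kc hk.
have ww : white w by rewrite (white_dist b) bw (negbTE bb).
have [|u bu cu] := dist_extend (tree_is_tree T) leafless (_ : c <> b).
  by move=> cb; move: bc; rewrite cb distxx.
have wu : white u by rewrite (white_dist b) bu (negbTE bb).
have [t wt] := white_generator_exists ww.
have [s us] := white_generator_exists wu.
have tb : stabV b t by apply: (generator_fix wt); rewrite distC bw.
have sb : stabV b s by apply: (generator_fix us); rewrite distC bu.
have [[i [j [l [l0 rel]]]]|[i [j [j0 kt]]]] :=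
    rank2_relation (black_rank2 bb) kb tb sb k1; last first.
  (* Here a nonzero power of [t] is a power of [k], so [h] commutes with it. *)
  apply: (centralizer_generator_power wt j0); rewrite -kt.
  exact: commute_zexpg.
have tc : stabV c t by apply: (generator_fix wt); rewrite wc.
have : stabV c (zexpg s l).
  move/mulg1_eq: rel => <-; apply: subgroupV; first exact: stabV_subgroup.
  by apply: stabVM; apply: stabV_zexpg.
have [_ _ _ _ sn] := us.
by rewrite (sn l)// (distC _ u) cu (distC _ c) bc.
Qed.

(** The fixed subtree of [k] is invariant under its centralizer. Without black vertices it is a
    single white vertex; with exactly one black vertex, that one is fixed; with two, [b] and [c],
    [centralizer_fix_white] applies to the neighbour of [b] towards [c]. *)
Lemma centralizer_fix k x : k <> 1 -> stabV x k ->
  exists y, forall h, commute h k -> stabV y h.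
Proof.
move=> k1 kx.
have kh y h : stabV y k -> commute h k -> stabV (actV h y) k.
  by move=> ky hk; apply: stabV_commute => //; apply: commute_sym.
have [[b [bb kb]]|nb] :=
    pselect (exists b, ~~ white b /\ stabV b k); last first.
  have white_fix y : stabV y k -> white y.
    by move=> ky; apply: contrapT => /negP by_; apply: nb; exists y.
  exists x => h hk; apply: contrapT => nhx.
  case E: (d x (actV h x)) => [|n]; first by move/dist_eq0: E => /esym.
  have [z xz zhx] := dist_step E.
  have kz : stabV z k.
    by apply: (fix_between kx (kh x h kx hk)); rewrite xz zhx E.
  by have := white_fix z kz; rewrite (white_dist x) xz white_fix.
have [[c [cb kc nbc]]|nc] :=
    pselect (exists c, [/\ ~~ white c, stabV c k & b <> c]); last first.
  exists b => h hk; apply: contrapT => nhb; apply: nc; exists (actV h b).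
  by split; [rewrite act_white|apply: kh|move=> hb; apply: nhb].
have [n bc] : exists n, d b c = n.+2.
  case E: (d b c) => [|[|n]]; last by exists n.
    by move/dist_eq0: E.
  have := white_dist b c; rewrite E.
  by case: (white b) bb cb => //= _ /negbTE ->.
have [w bw wc] := dist_step bc; have [e we ec] := dist_step wc.
have tri1 := dist_triangle (tree_is_tree T) e b c.
have tri2 := dist_triangle (tree_is_tree T) w b e.
have ke : stabV e k by apply: (fix_between kb kc); lia.
exists w => h; apply: (centralizer_fix_white bb bw we _ k1 kb ke); lia.
Qed.

(** The geodesic from [x] to [actV g x] and its image under [g] do not fold together at [actV g x]:
    if the displacement exceeds 1, a fold would make [g] move the second vertex [y] of the geodesic
    less than [x]. *)
Lemma translation_length g x l : d x (actV g x) = l.+1 ->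
  (forall y, (l.+1 <= d y (actV g y))%N) ->
  d x (actV g (actV g x)) = l.+1.*2.
Proof.
move=> xgx lmin; have [y xy ygx] := dist_step xgx.
have gxy : d (actV g x) (actV g y) = 1%N by rewrite dist_act.
have gygx : d (actV g y) (actV g (actV g x)) = l by rewrite dist_act.
have ggx : d (actV g x) (actV g (actV g x)) = l.+1 by rewrite dist_act.
have := lmin y.
have h1 := dist_triangle (tree_is_tree T) (actV g x) y (actV g y).
have h2 := four_point (tree_is_tree T) x (actV g x) y (actV g y).
have h3 := four_point (tree_is_tree T) x (actV g y) (actV g x)
  (actV g (actV g x)).
rewrite (distC _ (actV g x) y) in h2.
rewrite (distC _ (actV g y) (actV g x)) in h3.
have h4 := dist_triangle (tree_is_tree T) (actV g x) x (actV g (actV g x)).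
case: l => [|l] in xgx lmin ygx gygx ggx *; last by lia.
(* For displacement 1, parity and the triangle inequality leave distances 0 and 2, and 0 would make
   [g] invert [e]. *)
move=> _; have [e ex egx] := dist1_edge xgx.
have : odd (d x (actV g (actV g x))) = false.
  have := white_dist x (actV g (actV g x)); rewrite !act_white.
  by case: (white x) (odd _) => [] [].
case E: (d x _) => [|[|[|n]]] // _; [|by lia].
move/dist_eq0: E => xggx; case: (@act_noinv _ T g e).
apply: (edge_ext (tree_is_tree T)).
  by rewrite act_src ex /src erevK egx.
by rewrite act_tgt egx -xggx -ex.
Qed.

(** Were [t] to fix nothing, [B] would act freely by [centralizer_fix]; a nontrivial element of
    least displacement, over all vertices, would then generate [B]. *)
Lemma rank2_elliptic (B : set gT) t :
  free_abelian_rank2 B -> B t -> t <> 1 -> exists x, stabV x t.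
Proof.
move=> B2 Bt t1; apply: contrapT => nfix.
have BC g h : B g -> B h -> commute g h by apply: rank2_abelian.
have Bfree g x : B g -> g <> 1 -> actV g x <> x.
  move=> Bg g1 gx; have [y yC] := centralizer_fix g1 gx.
  by apply: nfix; exists y; apply/yC/BC.
have [[x0] _ _] := tree_is_tree T.
have [|[g x] /= [Bg g1] gmin] := @ex_argmin (gT * vert T)
    (fun gx => B gx.1 /\ gx.1 <> 1) (fun gx => d gx.2 (actV gx.1 gx.2)) (t, x0).
  by [].
have [l xgx] : exists l, d x (actV g x) = l.+1.
  case E: (d x (actV g x)) => [|l]; last by exists l.
  by case: (Bfree g x Bg g1); move/dist_eq0: E.
have lmin h y : B h -> h <> 1 -> (l.+1 <= d y (actV h y))%N.
  by move=> Bh h1; rewrite -xgx; apply: (gmin (h, y)).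
have xggx := translation_length xgx (fun y => lmin g y Bg g1).
(* So [g] generates [B]: the translates of [s x] by the powers of [g] come closer
   to [x] than the minimal displacement. *)
apply: (rank2_not_cyclic B2 (x := g)) => s Bs.
have [n _ nmin] := @ex_argmin int (fun=> True)
  (fun n => d x (actV (zexpg g n) (actV s x))) 0%R I.
pose h := zexpg g n * s.
have sB := rank2_subgroup B2.
have Bh : B h by apply: subgroupM => //; apply: subgroup_zexpg.
have gh : g * h = h * g by apply: BC.
suff h1 : h = 1.
  exists (- n)%R => //; apply: (mulgI (zexpg g n)).
  by rewrite -zexpgD GRing.subrr -/h h1.
apply: contrapT => h1; have := lmin h x Bh h1.
pose z := actV h x.
have hg y : actV g (actV h y) = actV h (actV g y) by rewrite -!actVM gh.
have zgz : d z (actV g z) = l.+1 by rewrite /z hg dist_act.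
have Vz : d (actV g^-1 z) z = l.+1 by rewrite -zgz -(dist_act g) actVKV.
have VVz : d (actV g^-1 z) (actV g z) = l.+1.*2.
  by rewrite -(dist_act g) actVKV /z !hg dist_act xggx.
have z1 : (d x z <= d x (actV g z))%N.
  have := nmin (n + 1)%R I; rewrite GRing.addrC zexpgD /= -!actVM.
  by rewrite /z /h actVM !mulgA.
have z2 : (d x z <= d x (actV g^-1 z))%N.
  have := nmin (n - 1)%R I; rewrite GRing.addrC zexpgD /= -!actVM.
  by rewrite /z /h actVM !mulgA.
have gxz : d (actV g x) z = d x (actV g^-1 z).
  by rewrite -[RHS](dist_act g) actVKV.
have gxgz : d (actV g x) (actV g z) = d x z by rewrite dist_act.
(* By this inequality one of [actV g z], [actV g^-1 z] is at distance at least [d x z + l.+1] from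
   [x]; the next one then gives [2 * d x z <= l.+1], against the minimality of [l.+1]. *)
have := four_point (tree_is_tree T) x z (actV g^-1 z) (actV g z).
have := four_point (tree_is_tree T) x (actV g z) (actV g x) z.
rewrite (distC _ (actV g z) z) (distC _ (actV g z) (actV g x)).
rewrite (distC _ z (actV g^-1 z)) -/z; lia.
Qed.

(** * Vertices and adjacency read off from stabilizers *)

Lemma white_nonabelian v : white v -> ~ set_abelian (stabV v).
Proof.
move=> wv ab; have [b [_ [vb _ _]]] := two_nbrs v.
have [|u bu vu] := dist_extend (tree_is_tree T) leafless (_ : v <> b).
  by move=> vbE; move: vb; rewrite vbE distxx.
have wu : white u by rewrite (white_dist v) vu vb wv.
have [t vt] := white_generator_exists wv.
have [s us] := white_generator_exists wu.
have vs : stabV v s by apply: (generator_fix us); rewrite distC vu vb.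
(* Commutativity would make [s] central, hence a nonzero power of [t]; the balls of radius 2 around
   [u] and [v] would coincide. *)
have [_ _ _ /(_ s vs) cs tn] := vt.
have [|n _ sE] := cs; first by move=> h vh; apply: ab.
have [n0|/eqP n0] := eqVneq n 0%R.
  by case: (generator_neq1 us); rewrite -sE n0.
have uv : u = v.
  apply: ball2_inj => x; rewrite -(tn n)// sE.
  have [_ _ _ _ sn] := us; exact: iff_sym (sn 1%R x _).
by move: vu; rewrite uv distxx.
Qed.

(** Fixing two vertices means fixing an edge between them, hence a black vertex, whose stabilizer is
    abelian. *)
Lemma fix_white_uniq (H : set gT) v w : ~ set_abelian H ->
  H `<=` stabV v -> H `<=` stabV w -> v = w.
Proof.
move=> nab Hv Hw; apply: contrapT => nvw; apply: nab => g h Hg Hh.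
case E: (d v w) => [|n]; first by move/dist_eq0: E.
have [z vz zw] := dist_step E.
have Hz : H `<=` stabV z.
  by move=> k Hk; apply: (fix_between (Hv k Hk) (Hw k Hk)); rewrite E vz zw.
have [bv|wv] := boolP (~~ white v).
  by apply: (rank2_abelian (black_rank2 bv)); apply: Hv.
have bz : ~~ white z by rewrite (white_dist v) vz; move: wv; case: white.
by apply: (rank2_abelian (black_rank2 bz)); apply: Hz.
Qed.

Lemma white_dist_le2 v w : white v -> white w -> (d v w <= 2)%N <->
  (forall g, stabV v g -> (forall h, stabV v h -> commute g h) -> stabV w g).
Proof.
move=> wv ww; have [t [it vt tc ct tn]] := white_generator_exists wv; split.
  move=> vw g vg gc; have [n _ <-] := ct g vg gc.
  by apply: stabV_zexpg; apply: (tn 1%R w _).2.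
move=> cw; apply/(tn 1%R w) => //; apply: cw => // h vh.
exact/commute_sym/tc.
Qed.

(** Adjacency to the midpoint [b] becomes a condition on white vertices, which [a] preserves. For
    the converse, the four-point inequality gives [d b v <= 1] and the colours exclude 0. *)
Lemma black_adj u1 u2 b v : d b u1 = 1%N -> d b u2 = 1%N -> d u1 u2 = 2%N ->
  white u1 -> white v -> d b v = 1%N <-> (d v u1 <= 2)%N /\ (d v u2 <= 2)%N.
Proof.
move=> b1 b2 u12 w1 wv; split.
  move=> bv; have tri := dist_triangle (tree_is_tree T) b v.
  by have := tri u1; have := tri u2; rewrite (distC _ v b); lia.
move=> [v1 v2]; have bb : ~~ white b.
  by move: (white_dist b u1); rewrite w1 b1; case: white.
have := white_dist b v; rewrite wv (negbTE bb) /=.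
have := four_point (tree_is_tree T) b v u1 u2; rewrite b1 b2 u12.
by case: (d b v) => [|[|[|n]]] //; lia.
Qed.

(** * The tree automorphism induced by a group automorphism *)

(** The tree automorphism is first a relation, [twin], made a map by choice once existence and
    uniqueness are known; black vertices are matched through their white neighbours. *)
Definition white_twin (a : gT -> gT) v w :=
  [/\ white v, white w & forall g, stabV v g <-> stabV w (a g)].

Definition black_twin (a : gT -> gT) b c :=
  [/\ ~~ white b, ~~ white c
    & forall v w, white_twin a v w -> d b v = 1%N <-> d c w = 1%N].

Definition twin (a : gT -> gT) x y := white_twin a x y \/ black_twin a x y.

Lemma stabV_act g x h : stabV (actV g x) h <-> stabV x (h ^ g).
Proof.
rewrite /stabV /= conjgE !actVM.
by split=> [->|]; [rewrite actVK|move=> {2}<-; rewrite actVKV].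
Qed.

Lemma dist_actl g x y : d (actV g x) y = d x (actV g^-1 y).
Proof. by rewrite -{1}(actVKV g y) dist_act. Qed.

Lemma image_fix_white (a : UMagmaMorphism.type gT gT) v : injective a -> white v ->
  exists2 w : vert T, white w & forall g, stabV v g -> stabV w (a g).
Proof.
move=> aI wv; have [t vt] := white_generator_exists wv.
have [b vb] := has_nbr v.
have bb : ~~ white b by rewrite (white_dist v) vb wv.
have a1 : a 1 = 1 by apply: gmulf1.
have B2 : free_abelian_rank2 [set a g | g in stabV b].
  have [f [fD fI fB]] := black_rank2 bb; exists (a \o f); split.
  - by move=> x y; rewrite /= fD gmulfM.
  - exact: inj_comp.
  - by rewrite -fB image_comp.
have at1 : a t <> 1 by rewrite -a1 => /aI; apply: generator_neq1 vt.
have [|x xt] := rank2_elliptic B2 _ at1.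
  by exists t => //; apply: (generator_fix vt); rewrite vb.
have [y yt] := centralizer_fix at1 xt.
have [_ _ ct _ _] := vt.
have vy g : stabV v g -> stabV y (a g).
  by move=> vg; apply: yt; apply: gmulf_commute; apply: ct.
exists y => //; apply: contrapT => /negP by_; apply: (white_nonabelian wv).
move=> g h vg vh; apply: aI; rewrite !gmulfM.
by apply: (rank2_abelian (black_rank2 by_)); apply: vy.
Qed.

Section Twin.
Variables a b : UMagmaMorphism.type gT gT.
Hypotheses (aK : cancel a b) (bK : cancel b a).

Lemma white_twin_sym v w : white_twin a v w -> white_twin b w v.
Proof. by move=> [wv ww vw]; split=> // g; rewrite vw bK. Qed.

Lemma white_twin_act v w g :
  white_twin a v w -> white_twin a (actV g v) (actV (a g) w).
Proof.
move=> [wv ww vw]; split; rewrite ?act_white// => h.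
by rewrite !stabV_act vw gmulfJ.
Qed.

Lemma white_twin_exists v : white v -> exists w, white_twin a v w.
Proof.
move=> wv; have [w ww vw] := image_fix_white (can_inj aK) wv.
have [v' wv' wv'b] := image_fix_white (can_inj bK) ww.
(* [stabV v] fixes both vertices; their equality turns the two inclusions of stabilizers into
   equalities. *)
have E : v = v'.
  apply: (fix_white_uniq (white_nonabelian wv)) => // g /vw/wv'b.
  by rewrite aK.
exists w; split=> // g; split=> [|/wv'b]; first exact: vw.
by rewrite aK E.
Qed.

Lemma white_twin_fun v w w' : white_twin a v w -> white_twin a v w' -> w = w'.
Proof.
move=> [_ ww vw] [_ _ vw']; apply: (fix_white_uniq (white_nonabelian ww)) => //.
by move=> g; rewrite -{1}(bK g) -vw vw' bK.
Qed.

Lemma white_twin_dist v w v' w' : white_twin a v w -> white_twin a v' w' ->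
  (d v v' <= 2)%N -> (d w w' <= 2)%N.
Proof.
move=> [wv ww vw] [wv' ww' vw'] /(white_dist_le2 wv wv') vv'.
apply/(white_dist_le2 ww ww') => g wg gc; rewrite -(bK g) -vw'; apply: vv'.
  by rewrite vw bK.
move=> h vh; apply: (can_inj aK); rewrite !gmulfM bK.
by apply: gc; rewrite -vw.
Qed.

End Twin.

Section BlackTwin.
Variables a b : UMagmaMorphism.type gT gT.
Hypotheses (aK : cancel a b) (bK : cancel b a).

Lemma white_twin_dist2 v w v' w' : white_twin a v w -> white_twin a v' w' ->
  (d v v' <= 2)%N <-> (d w w' <= 2)%N.
Proof.
move=> vw vw'; split; first exact: (white_twin_dist aK bK).
by apply: (white_twin_dist bK aK); apply: white_twin_sym.
Qed.

Lemma black_nbr_twins x : ~~ white x -> exists u1 u2 w1 w2,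
  [/\ white_twin a u1 w1, white_twin a u2 w2, d x u1 = 1, d x u2 = 1
    & d u1 u2 = 2]%N /\ d w1 w2 = 2%N.
Proof.
move=> bx; have [u1 [u2 [x1 x2 u12]]] := two_nbrs x.
have wu1 : white u1 by rewrite (white_dist x) x1 (negbTE bx).
have wu2 : white u2 by rewrite (white_dist x) x2 (negbTE bx).
have [w1 uw1] := white_twin_exists aK bK wu1.
have [w2 uw2] := white_twin_exists aK bK wu2.
exists u1, u2, w1, w2; split=> //.
have : (d w1 w2 <= 2)%N by apply/(white_twin_dist2 uw1 uw2); rewrite u12.
have [_ ww1 _] := uw1; have [_ ww2 _] := uw2.
have := white_dist w1 w2; rewrite ww1 ww2.
(* Parity leaves distances 0 and 2, and 0 would identify [u1] with [u2]. *)
case E: (d w1 w2) => [|[|[|n]]] // _ _; move/dist_eq0: E => E.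
have u12E : u1 = u2.
  apply: (white_twin_fun aK) (white_twin_sym bK uw1) _.
  by rewrite E; apply: white_twin_sym.
by move: u12; rewrite u12E distxx.
Qed.

(** The twin is the midpoint of the twins of two neighbours of [x]; [black_adj] describes the
    neighbours of both by corresponding conditions. *)
Lemma black_twin_exists x : ~~ white x -> exists y, black_twin a x y.
Proof.
move=> bx; have [u1 [u2 [w1 [w2 [[uw1 uw2 x1 x2 u12] w12]]]]] := black_nbr_twins bx.
have [y y1 y2] := dist_step w12; rewrite distC in y1.
have [wu1 ww1 _] := uw1.
exists y; split=> //; first by rewrite (white_dist w1) distC y1 ww1.
move=> v w vw; have [wv ww _] := vw.
rewrite (black_adj x1 x2 u12 wu1 wv) (black_adj y1 y2 w12 ww1 ww).
by rewrite (white_twin_dist2 vw uw1) (white_twin_dist2 vw uw2).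
Qed.

Lemma black_twin_fun x y y' : black_twin a x y -> black_twin a x y' -> y = y'.
Proof.
move=> [bx _ xy] [_ _ xy'].
have [u1 [u2 [w1 [w2 [[uw1 uw2 x1 x2 u12] w12]]]]] := black_nbr_twins bx.
have y1 := (xy _ _ uw1).1 x1; have y2 := (xy _ _ uw2).1 x2.
have y1' := (xy' _ _ uw1).1 x1; have y2' := (xy' _ _ uw2).1 x2.
apply: (@between_uniq _ (tree_is_tree T) w1 w2).
- by rewrite (distC _ w1 y) (distC _ w1 y') y1.
- by rewrite y2.
- by rewrite (distC _ w1 y) y1 y2.
Qed.

Lemma twin_exists x : exists y, twin a x y.
Proof.
have [/(white_twin_exists aK bK)|/black_twin_exists] := boolP (white x) => -[y xy].
  by exists y; left.
by exists y; right.
Qed.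

Lemma twin_fun x y y' : twin a x y -> twin a x y' -> y = y'.
Proof.
case=> xy [] xy'; [exact: (white_twin_fun bK) xy xy'| | |exact: black_twin_fun xy xy'].
  by case: xy xy' => [wx _ _] [/negP].
by case: xy xy' => [/negP bx _ _] [].
Qed.

Lemma twin_sym x y : twin a x y -> twin b y x.
Proof.
case=> [xy|[bx by_ xy]]; first by left; apply: white_twin_sym.
right; split=> // v w vw; apply: iff_sym; apply: xy.
exact: (white_twin_sym aK).
Qed.

Lemma twin_act x y g : twin a x y -> twin a (actV g x) (actV (a g) y).
Proof.
case=> [xy|[bx by_ xy]]; first by left; apply: white_twin_act.
right; split; rewrite ?act_white// => v w vw; rewrite !dist_actl -gmulfV.
exact/xy/white_twin_act.
Qed.

Lemma twin_adj x x' y y' : twin a x x' -> twin a y y' -> d x y = 1%N ->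
  d x' y' = 1%N.
Proof.
move=> xx' yy' xy; have := white_dist x y; rewrite xy.
case: xx' yy' => [xx'|[bx _ xx']] [yy'|[by_ _ yy']].
- by case: (xx') (yy') => [-> _ _] [->].
- by move=> _; rewrite distC; apply/(yy' _ _ xx'); rewrite distC.
- by move=> _; apply/(xx' _ _ yy').
- by rewrite (negbTE bx) (negbTE by_).
Qed.

End BlackTwin.

Lemma twisted_automorphism (a b : UMagmaMorphism.type gT gT) :
  cancel a b -> cancel b a -> exists F G : vert T -> vert T,
  [/\ cancel F G, cancel G F, forall g x, F (actV g x) = actV (a g) (F x),
      forall x y, d x y = 1%N -> d (F x) (F y) = 1%N
    & forall x y, d x y = 1%N -> d (G x) (G y) = 1%N].
Proof.
move=> aK bK; have [F aF] := choice (twin_exists aK bK).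
have [G bG] := choice (twin_exists bK aK); exists F, G; split.
- by move=> x; apply: (twin_fun bK aK (bG (F x))); apply: twin_sym.
- by move=> x; apply: (twin_fun aK bK (aF (G x))); apply: twin_sym.
- by move=> g x; apply: (twin_fun aK bK (aF _)); apply: twin_act.
- by move=> x y; apply: twin_adj.
- by move=> x y; apply: twin_adj.
Qed.

End Suspension.

Lemma tree_twisted_automorphism (gT : groupType) (T : coloured_tree gT)
    (a b : UMagmaMorphism.type gT gT) :
  canonical_structural_tree T -> cancel a b -> cancel b a ->
  exists F G : vert T -> vert T,
  [/\ cancel F G, cancel G F, forall g x, F (actV g x) = actV (a g) (F x),
      forall e, exists f, src f = F (src e) /\ tgt f = F (tgt e)
    & forall e, exists f, src f = G (src e) /\ tgt f = G (tgt e)].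
Proof.
move=> [pts leafless] aK bK.
have [nbr|isolated] :=
    pselect (forall x, exists y, dist (tree_is_tree T) x y = 1%N).
  have [F [G [FK GK Fa Fadj Gadj]]] := twisted_automorphism pts leafless nbr aK bK.
  have lift_edge (H : vert T -> vert T) (e : edge T) :
      dist (tree_is_tree T) (H (src e)) (H (tgt e)) = 1%N ->
      exists f, src f = H (src e) /\ tgt f = H (tgt e).
    by move=> /dist1_edge[f fs ft]; exists f.
  by exists F, G; split=> // e; apply: lift_edge;
    [apply: Fadj|apply: Gadj]; apply: dist_edge.
(* A vertex without neighbours is all of [T], by connectedness, and the identity is equivariant. *)
have [x xn] : exists x : vert T, forall y, dist (tree_is_tree T) x y <> 1%N.
  apply: contrapT => nex; apply: isolated => x; apply: contrapT => nx.
  by apply: nex; exists x => y xy; apply: nx; exists y.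
have xE y : y = x.
  case E: (dist (tree_is_tree T) x y) => [|n]; first by move/dist_eq0: E.
  by have [z /xn] := dist_step E.
exists id, id; split=> //; try by move=> e; exists e.
by move=> g y; rewrite (xE (actV g y)) (xE (actV (a g) y)).
Qed.

(** * Automorphisms of the quotient graph of groups *)

Section Realization.
Variables (gT : groupType) (T : coloured_tree gT) (Q : quotient_data T).
Variables (a b : UMagmaMorphism.type gT gT) (F G : vert T -> vert T).
Hypotheses (aK : cancel a b) (bK : cancel b a) (FK : cancel F G) (GK : cancel G F).
Hypothesis F_act : forall g x, F (actV g x) = actV (a g) (F x).
Variables FE GE : edge T -> edge T.
Hypotheses (FE_src : forall e, src (FE e) = F (src e))
  (FE_tgt : forall e, tgt (FE e) = F (tgt e))
  (GE_src : forall e, src (GE e) = G (src e))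
  (GE_tgt : forall e, tgt (GE e) = G (tgt e)).
Let ext := edge_ext (tree_is_tree T).
Local Notation X := (dual_gog Q).

Lemma G_act g x : G (actV g x) = actV (b g) (G x).
Proof. by apply: (can_inj FK); rewrite F_act !GK bK. Qed.

Lemma FEK : cancel FE GE.
Proof. by move=> e; apply: ext; rewrite ?GE_src ?GE_tgt ?FE_src ?FE_tgt FK. Qed.

Lemma GEK : cancel GE FE.
Proof. by move=> e; apply: ext; rewrite ?FE_src ?FE_tgt ?GE_src ?GE_tgt GK. Qed.

Lemma FE_act g e : FE (actE g e) = actE (a g) (FE e).
Proof.
apply: ext; first by rewrite FE_src !act_src F_act FE_src.
by rewrite FE_tgt !act_tgt F_act FE_tgt.
Qed.

Lemma GE_act g e : GE (actE g e) = actE (b g) (GE e).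
Proof. by apply: (can_inj FEK); rewrite FE_act !GEK bK. Qed.

Lemma FE_rev e : FE (erev e) = erev (FE e).
Proof.
apply: ext; first by rewrite FE_src /src !erevK FE_tgt.
by rewrite FE_tgt; apply: esym (FE_src e).
Qed.

Lemma qV_act g x : qV Q (actV g x) = qV Q x.
Proof. by apply/esym/qVP; exists g. Qed.

Lemma qE_act g e : qE Q (actE g e) = qE Q e.
Proof. by apply/esym/qEP; exists g. Qed.

Definition quotV (H : vert T -> vert T) (x : vert X) : vert X := qV Q (H (liftV x)).
Definition quotE (H : edge T -> edge T) (e : edge X) : edge X := qE Q (H (liftE e)).

(** Twisted equivariance makes the orbit of [H x] depend on the orbit of [x] only. *)
Lemma quotV_q (c : gT -> gT) (H : vert T -> vert T) x :
  (forall g y, H (actV g y) = actV (c g) (H y)) -> quotV H (qV Q x) = qV Q (H x).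
Proof.
by move=> H_act; have [g {2}->] := lift_orbitV Q x; rewrite H_act qV_act.
Qed.

Lemma quotE_q (c : gT -> gT) (H : edge T -> edge T) e :
  (forall g f, H (actE g f) = actE (c g) (H f)) -> quotE H (qE Q e) = qE Q (H e).
Proof.
by move=> H_act; have [g {2}->] := lift_orbitE Q e; rewrite H_act qE_act.
Qed.

Lemma quotV_bij : bijective (quotV F).
Proof.
exists (quotV G) => x.
  by rewrite (quotV_q _ G_act) FK liftVK.
by rewrite (quotV_q _ F_act) GK liftVK.
Qed.

Lemma quotE_bij : bijective (quotE FE).
Proof.
exists (quotE GE) => e.
  by rewrite (quotE_q _ GE_act) FEK liftEK.
by rewrite (quotE_q _ FE_act) GEK liftEK.
Qed.

Lemma quot_tgt (e : edge X) : tgt (quotE FE e) = quotV F (tgt e).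
Proof.
by rewrite -q_tgt FE_tgt -(quotV_q _ F_act) q_tgt liftEK.
Qed.

Lemma quot_rev (e : edge X) : quotE FE (erev e) = erev (quotE FE e).
Proof. by rewrite -q_rev -FE_rev -liftE_rev. Qed.

Definition quot_aut : graph_aut X := GraphAut quotV_bij quotE_bij quot_tgt quot_rev.

(** [F] may carry chosen lifts to other lifts; conjugation by [vcorr] and [ecorr] brings the image
    under [a] of a chosen stabilizer back to a chosen one. *)
Definition vcorr (x : vert X) : gT := sval (cid (lift_orbitV Q (F (liftV x)))).

Lemma vcorrP (x : vert X) : F (liftV x) = actV (vcorr x) (liftV (quotV F x)).
Proof. exact: svalP (cid (lift_orbitV Q (F (liftV x)))). Qed.

(* [xget] depends on the set only, hence [ecorr_rev]. *)
Definition ecorr (e : edge X) : gT :=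
  xget 1 [set k | FE (liftE e) = actE k (liftE (quotE FE e))].

Lemma ecorrP (e : edge X) : FE (liftE e) = actE (ecorr e) (liftE (quotE FE e)).
Proof.
rewrite {1}/ecorr; set S := mkset _; suff : S (xget 1 S) by [].
by apply: xgetPex; apply: lift_orbitE.
Qed.

Lemma ecorr_rev (e : edge X) : ecorr (erev e) = ecorr e.
Proof.
congr xget; apply/seteqP; rewrite quot_rev !liftE_rev FE_rev.
split=> k /=; rewrite -act_rev; last by move=> ->.
exact: (can_inj (@erevK T)).
Qed.

Lemma stabV_F g (x : vert T) : stabV (F x) (a g) <-> stabV x g.
Proof. by rewrite /stabV /= -F_act; split=> [/(can_inj FK)|->]. Qed.

Lemma stabE_F g (e : edge T) : stabE (FE e) (a g) <-> stabE e g.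
Proof. by rewrite /stabE /= -FE_act; split=> [/(can_inj FEK)|->]. Qed.

Lemma stabE_act g (e : edge T) h : stabE (actE g e) h <-> stabE e (h ^ g).
Proof.
rewrite /stabE /= conjgE !actEM.
by split=> [->|]; [rewrite actEK|move=> {2}<-; rewrite actEKV].
Qed.

Lemma conj_set_bij (A B : set gT) k :
  (forall g, A g <-> B (a g ^ k)) -> set_bij A B (fun g => a g ^ k).
Proof.
move=> AB; split=> [g /AB//|g h _ _ /conjg_inj/(can_inj aK)//|y By].
by exists (b (y ^ k^-1)); rewrite ?bK ?conjgKV//; apply/AB; rewrite bK conjgKV.
Qed.

(** Both factors, before inversion, carry the chosen lift of the image of [tgt e] to the terminal
    vertex of [FE (liftE e)], so their quotient fixes that lift. *)
Definition corr_gamma (e : edge X) : gT :=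
  (ecorr e * lift_elt (quotE FE e))^-1 * (a (lift_elt e) * vcorr (tgt e)).

Lemma corr_gammaP (e : edge X) : gV (quotV F (tgt e)) (corr_gamma e).
Proof.
have E : actV (a (lift_elt e) * vcorr (tgt e)) (liftV (quotV F (tgt e))) =
         actV (ecorr e * lift_elt (quotE FE e)) (liftV (tgt (quotE FE e))).
  rewrite !actVM -vcorrP -F_act (@lift_eltP _ _ Q) (@lift_eltP _ _ Q).
  by rewrite -act_tgt -ecorrP FE_tgt.
rewrite /gV /= /stabV /= /corr_gamma actVM E quot_tgt; exact: actVK.
Qed.

Lemma corr_dV_bij (x : vert X) :
  set_bij (gV x) (gV (quotV F x)) (fun g => a g ^ vcorr x).
Proof.
by apply: conj_set_bij => g; rewrite /= -stabV_act -vcorrP stabV_F.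
Qed.

Lemma corr_dE_bij (e : edge X) :
  set_bij (gE e) (gE (quotE FE e)) (fun g => a g ^ ecorr e).
Proof.
by apply: conj_set_bij => g; rewrite /= -stabE_act -ecorrP stabE_F.
Qed.

Lemma corr_att (e : edge X) x :
  a (att e x) ^ vcorr (tgt e) =
  att (quotE FE e) (a x ^ ecorr e) ^ corr_gamma e.
Proof. by rewrite /= /corr_gamma gmulfJ -!conjgM [ecorr e * _]mulgA mulVKg. Qed.

Definition realization : deltaAut X.
Proof.
apply: (@DeltaAut _ X quot_aut (fun x g => a g ^ vcorr x)
  (fun e g => a g ^ ecorr e) corr_gamma _ corr_dV_bij _ corr_dE_bij _
  corr_gammaP).
- by move=> x g h _ _; rewrite gmulfM conjMg.
- by move=> e g h _ _; rewrite gmulfM conjMg.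
- by move=> e g _; rewrite ecorr_rev.
- by move=> e x _; apply: corr_att.
Defined.

(** An edge contributes [a] of its value between corrections at its two ends, the terms [ecorr]
    cancelling by [ecorr_rev]; along a path the product telescopes. *)
Lemma realization_eval u x w : bpath u x w ->
  dual_eval (delta_bass realization x) = (vcorr u)^-1 * a (dual_eval x) * vcorr w.
Proof.
elim=> [{}u g gu|e g ge {}x {}w _ IH].
  by rewrite delta_bassV !dual_evalV /= conjgE mulgA.
rewrite !delta_bassM delta_bassV delta_bassE !dual_evalM IH evV /dgammab.
rewrite !dual_evalV !dual_evalE /= /corr_gamma ecorr_rev quot_rev.
rewrite !gmulfM gmulfV -/(src e) conjgE !invgM !invgK !mulgA.
by rewrite !mulgK.
Qed.

(** On loops at [v] the two boundary factors of [realization_eval] amount to conjugation by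
    [vcorr v], which is trivial in [Out]. *)
Lemma realization_natural_map (al : automorphism gT) (v : vert X) :
  al =1 a -> natural_map realization v = out_class al.
Proof.
move=> alE; apply/out_classP; exists (vcorr v)^-1 => g.
rewrite /= /natural_fun (realization_eval (dual_inv_pi1 v g)) dual_invK alE.
by rewrite -[_ * a g * _]mulgA -conjgE conjgK.
Qed.

End Realization.

Theorem proposition3p6 (Gam : groupType) (T : coloured_tree Gam)
    (hT : canonical_structural_tree T)
    (Q : quotient_data T) (v : vert (dual_gog Q)) :
  forall o : Out Gam, exists D : deltaAut (dual_gog Q), natural_map D v = o.
Proof.
move=> o; rewrite -[o]reprK -/(out_class (repr o)).
set al : automorphism Gam := repr o; have [b0 aK bK] := aut_bij al.
have b0M := can2_gmulfM aK bK.
have mor1 (f : Gam -> Gam) : {morph f : x y / x * y} -> f 1 = 1.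
  by move=> fM; apply: (mulgI (f 1)); rewrite -fM !mulg1.
pose a : UMagmaMorphism.type Gam Gam := HB.pack (al : Gam -> Gam)
  (isMultiplicative.Build Gam Gam al (@gmulfM _ _ al))
  (Multiplicative_isUMagmaMorphism.Build Gam Gam al (mor1 al (@gmulfM _ _ al))).
pose b : UMagmaMorphism.type Gam Gam := HB.pack b0
  (isMultiplicative.Build Gam Gam b0 b0M)
  (Multiplicative_isUMagmaMorphism.Build Gam Gam b0 (mor1 b0 b0M)).
have abK : cancel a b := aK; have baK : cancel b a := bK.
have [F [G [FK GK F_act Fadj Gadj]]] := tree_twisted_automorphism hT abK baK.
have [FE FEP] := choice Fadj; have [GE GEP] := choice Gadj.
exists (realization Q abK baK FK GK F_act
  (fun e => (FEP e).1) (fun e => (FEP e).2) (fun e => (GEP e).1) (fun e => (GEP e).2)).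
exact: realization_natural_map.
Qed.
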